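(* Let $k$ be an algebraically closed field, $Q$ a finite quiver, $\mathcal I$ an arbitrary ideal of the path algebra $kQ$, $\Lambda=kQ/\mathcal I$, and $G\subseteq \mathrm{Aut}(Q,\mathcal I)$ a finite group with $\mathrm{char}\,k\nmid |G|$. Let $X$ be a finite dimensional indecomposable $\Lambda$-module such that $H_X=\{g\in G\mid {}^gX\cong X\}$ is abelian, let $G_X$ be a complete set of left coset representatives of $H_X$ in $G$, and let $kH_X=\bigoplus_{i=1}^r\rho_i$ ($r=|H_X|$) be the decomposition of the regular representation into irreducible (one dimensional, pairwise non-isomorphic) $H_X$-representations. Regard $X$ as a $\Lambda H_X$-module (a fixed $\Lambda H_X$-module structure extending the given $\Lambda$-module structure). Then for any $\Lambda G$-module $Y$ with $Y\cong\bigoplus_{g\in G_X}{}^gX$ as $\Lambda$-modules, there exists a unique $i\in\{1,2,\dots,r\}$ such that $$Y\cong \Lambda G\otimes_{\Lambda H_X}(\rho_i\otimes_k X)$$ as $\Lambda G$-modules. That is, there are exactly $r$ pairwise non-isomorphic $\Lambda G$-modules whose underlying $\Lambda$-module is isomorphic to the indecomposable $G$-invariant $\Lambda$-module $\bigoplus_{g\in G_X}{}^gX$.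
   Context: $\mathrm{Aut}(Q,\mathcal I)=\{\alpha\in\mathrm{Aut}(Q)\mid \alpha(\mathcal I)=\mathcal I\}$; such automorphisms act on $\Lambda=kQ/\mathcal I$ by algebra automorphisms. For a group $H$ acting on an algebra $\Lambda$, the skew group algebra $\Lambda H$ is the $k$-algebra spanned by elements $ga$ ($g\in H$, $a\in\Lambda$; underlying space $kH\otimes_k\Lambda$), with multiplication $ga\cdot hb=gh\,h^{-1}(a)\,b$ (so $g(a)=gag^{-1}$). All modules are finite dimensional left modules. For a $\Lambda$-module $X$ and $g\in G$, the twisted module ${}^gX$ is $X$ as a vector space with action $a\cdot x=g^{-1}(a)x$. A $\Lambda$-module $Y$ is $G$-invariant if ${}^gY\cong Y$ for all $g\in G$; it is indecomposable $G$-invariant if it is nonzero, $G$-invariant, and is not isomorphic to a direct sum of two nonzero $G$-invariant modules. Given a $\Lambda H_X$-module structure on $X$, the space $\rho_i\otimes_kX$ is a $\Lambda H_X$-module via $ga(l\otimes x)=gl\otimes gax$ for $g\in H_X$, $a\in\Lambda$, $l\in\rho_i$, $x\in X$. *)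

(* Defs.v *)
From HB Require Import structures.
From mathcomp Require Import all_boot all_order all_algebra all_fingroup all_solvable.
From mathcomp Require Import generic_quotient ring_quotient finmap.
From mathcomp.classical Require Import boolp.
From mathcomp.multinomials Require Import monalg.
Set Implicit Arguments.
Unset Strict Implicit.
Unset Printing Implicit Defensive.
Import GRing.Theory.
Local Open Scope ring_scope.

(* Unital associative k-algebras, presented as rings with a ring morphism from k
   with central image. MathComp's [algType k] is not used because it excludes
   the zero ring, which is a legitimate value of kQ (no vertex) and of kQ/I
   (I = kQ). *)
HB.mixin Record PzRing_isScalarAlg (k : pzRingType) A of GRing.PzRing A := {
  scal : k -> A;
  scal_zmod_morphism : zmod_morphism scal;
  scal_monoid_morphism : monoid_morphism scal;
  scalC : forall (c : k) (a : A), scal c * a = a * scal c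
}.

#[short(type="kalgType")]
HB.structure Definition ScalarAlg (k : pzRingType) :=
  {A of GRing.PzRing A & PzRing_isScalarAlg k A}.

HB.instance Definition _ (k : pzRingType) (A : kalgType k) :=
  GRing.isZmodMorphism.Build k A (@scal k A) scal_zmod_morphism.
HB.instance Definition _ (k : pzRingType) (A : kalgType k) :=
  GRing.isMonoidMorphism.Build k A (@scal k A) scal_monoid_morphism.

Section Self.
Variable k : comNzRingType.
Fact self_scal_zmod_morphism : zmod_morphism (fun c : k => c : k^o).
Proof. by []. Qed.
Fact self_scal_monoid_morphism : monoid_morphism (fun c : k => c : k^o).
Proof. by []. Qed.
HB.instance Definition _ := PzRing_isScalarAlg.Build k k^o
  self_scal_zmod_morphism self_scal_monoid_morphism (@mulrC k).
End Self.

Definition iso (R : pzRingType) (M N : lmodType R) : Prop :=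
  exists f : {linear M -> N}, bijective f.

Definition zero_mod (R : pzRingType) (M : lmodType R) : Prop :=
  forall x : M, x = 0.

Definition indecomposable (R : pzRingType) (M : lmodType R) : Prop :=
  ~ zero_mod M /\
  forall N P : lmodType R, iso M (N * P)%type -> zero_mod N \/ zero_mod P.

Definition irreducible (R : pzRingType) (M : lmodType R) : Prop :=
  ~ zero_mod M /\
  forall U : M -> Prop, U 0 -> (forall a x y, U x -> U y -> U (a *: x + y)) ->
    (forall x, U x -> x = 0) \/ (forall x, U x).

(* Finite dimension over k of a module over the k-algebra A. *)
Definition fin_dim (k : pzRingType) (A : kalgType k) (M : lmodType A) : Prop :=
  exists (n : nat) (b : 'I_n -> M), forall x : M,
    exists c : 'I_n -> k, x = \sum_(i < n) (scal (c i) : A) *: b i.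

(* The module M with scalars restricted along phi. *)
Definition res (R S : pzRingType) (phi : {rmorphism R -> S}) (M : lmodType S)
  : Type := M.

Section Restriction.
Variables (R S : pzRingType) (phi : {rmorphism R -> S}) (M : lmodType S).
HB.instance Definition _ := GRing.Zmodule.on (res phi M).
Definition res_scale (a : R) (x : res phi M) : res phi M := phi a *: (x : M).
Fact res_scalerA a b x : res_scale a (res_scale b x) = res_scale (a * b) x.
Proof. by rewrite /res_scale scalerA rmorphM. Qed.
Fact res_scale1r : left_id 1 res_scale.
Proof. by move=> x; rewrite /res_scale rmorph1 scale1r. Qed.
Fact res_scalerDr : right_distributive res_scale +%R.
Proof. by move=> a x y; rewrite /res_scale scalerDr. Qed.
Fact res_scalerDl x : {morph res_scale^~ x : a b / a + b}.
Proof. by move=> a b; rewrite /res_scale rmorphD scalerDl. Qed.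
HB.instance Definition _ := GRing.Zmodule_isLmodule.Build R (res phi M)
  res_scalerA res_scale1r res_scalerDr res_scalerDl.
End Restriction.

Definition dsum (R : pzRingType) (I : finType) (M : I -> lmodType R) : Type :=
  {dffun forall i : I, M i}.

Section DirectSum.
Variables (R : pzRingType) (I : finType) (M : I -> lmodType R).
Local Notation D := (dsum M).
HB.instance Definition _ := Choice.on D.
Definition dsum_zero : D := [ffun i => 0 : M i].
Definition dsum_opp (x : D) : D := [ffun i => - x i].
Definition dsum_add (x y : D) : D := [ffun i => x i + y i].
Definition dsum_scale (a : R) (x : D) : D := [ffun i => a *: x i].
Fact dsum_addA : associative dsum_add.
Proof. by move=> x y z; apply/ffunP=> i; rewrite !ffunE addrA. Qed.
Fact dsum_addC : commutative dsum_add.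
Proof. by move=> x y; apply/ffunP=> i; rewrite !ffunE addrC. Qed.
Fact dsum_add0 : left_id dsum_zero dsum_add.
Proof. by move=> x; apply/ffunP=> i; rewrite !ffunE add0r. Qed.
Fact dsum_addN : left_inverse dsum_zero dsum_opp dsum_add.
Proof. by move=> x; apply/ffunP=> i; rewrite !ffunE addNr. Qed.
HB.instance Definition _ :=
  GRing.isZmodule.Build D dsum_addA dsum_addC dsum_add0 dsum_addN.
Fact dsum_scalerA a b x : dsum_scale a (dsum_scale b x) = dsum_scale (a * b) x.
Proof. by apply/ffunP=> i; rewrite !ffunE scalerA. Qed.
Fact dsum_scale1r : left_id 1 dsum_scale.
Proof. by move=> x; apply/ffunP=> i; rewrite !ffunE scale1r. Qed.
Fact dsum_scalerDr : right_distributive dsum_scale +%R.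
Proof. by move=> a x y; apply/ffunP=> i; rewrite !ffunE scalerDr. Qed.
Fact dsum_scalerDl x : {morph dsum_scale^~ x : a b / a + b}.
Proof. by move=> a b; apply/ffunP=> i; rewrite !ffunE scalerDl. Qed.
HB.instance Definition _ := GRing.Zmodule_isLmodule.Build R D
  dsum_scalerA dsum_scale1r dsum_scalerDr dsum_scalerDl.
End DirectSum.

Record subgroup (V : zmodType) := Subgroup {
  sg_mem :> V -> Prop;
  sg_0 : sg_mem 0;
  sg_B : forall x y, sg_mem x -> sg_mem y -> sg_mem (x - y)
}.

Definition sg_pred (V : zmodType) (U : subgroup V) (x : V) : bool := `[< U x >].
Fact sg_pred_closed (V : zmodType) (U : subgroup V) : zmod_closed (sg_pred U).
Proof.
split=> [|x y /asboolP Ux /asboolP Uy]; apply/asboolP; first exact: sg_0.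
exact: sg_B.
Qed.
HB.instance Definition _ (V : zmodType) (U : subgroup V) :=
  GRing.isZmodClosed.Build V (sg_pred U) (sg_pred_closed U).

Definition sg_closed (V : zmodType) (U : subgroup V) : zmodClosed V :=
  GRing.ZmodClosed.clone V (sg_pred U) _.

Definition quo (V : zmodType) (U : subgroup V) : Type :=
  Quotient.quot (sg_closed U).
HB.instance Definition _ (V : zmodType) (U : subgroup V) :=
  GRing.Zmodule.on (quo U).

Section Quo.
Variables (V : zmodType) (U : subgroup V).
Local Notation Q := (Quotient.quot (sg_closed U)).
Definition quo_pi (x : V) : quo U := \pi_Q%qT x.
Definition quo_repr (x : quo U) : V := repr (x : Q).
Lemma quo_reprK x : quo_pi (quo_repr x) = x.
Proof. exact: reprK. Qed.
Lemma quo_piP x y : quo_pi x = quo_pi y <-> U (x - y).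
Proof.
have h : ((x - y) \in sg_closed U) = (quo_pi x == quo_pi y :> Q).
  exact: Quotient.idealrBE.
split=> [/eqP|Uxy]; first by rewrite -h => /asboolP.
by apply/eqP; rewrite -h; apply/asboolP.
Qed.
Fact quo_pi_is_additive : zmod_morphism quo_pi.
Proof. by move=> x y; apply: (@raddfB _ _ \pi_Q%qT). Qed.
HB.instance Definition _ := GRing.isZmodMorphism.Build V (quo U) quo_pi
  quo_pi_is_additive.
End Quo.

Section QuotientAlgebra.
Variable k : pzRingType.

Record ideal (A : pzRingType) := Ideal {
  ideal_sg :> subgroup A;
  idealMl : forall a x, ideal_sg x -> ideal_sg (a * x);
  idealMr : forall a x, ideal_sg x -> ideal_sg (x * a)
}.

Definition quo_alg (A : pzRingType) (I : ideal A) : Type := quo I.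

Section Ring.
Variables (A : pzRingType) (I : ideal A).
Local Notation Q := (quo_alg I).
HB.instance Definition _ := GRing.Zmodule.on Q.
Definition qpi (x : A) : Q := quo_pi I x.
HB.instance Definition _ := GRing.isZmodMorphism.Build A Q qpi
  (quo_pi_is_additive I).
Definition qrepr (x : Q) : A := quo_repr x.
Lemma qreprK x : qpi (qrepr x) = x. Proof. exact: quo_reprK. Qed.
Lemma qpiP x y : qpi x = qpi y <-> I (x - y). Proof. exact: quo_piP. Qed.
Definition quo_one : Q := qpi 1.
Definition quo_mul (x y : Q) : Q := qpi (qrepr x * qrepr y).
Lemma quo_mulE a b : quo_mul (qpi a) (qpi b) = qpi (a * b).
Proof.
apply/qpiP; set a' := qrepr _; set b' := qrepr _.
have -> : a' * b' - a * b = (a' - a) * b' - a * (b - b').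
  by rewrite mulrBl mulrBr opprB addrA subrK.
by apply: sg_B; [apply: idealMr | apply: idealMl]; apply/qpiP; rewrite qreprK.
Qed.
Fact quo_mulA : associative quo_mul.
Proof.
move=> x y z; rewrite -[x]qreprK -[y]qreprK -[z]qreprK.
by rewrite !quo_mulE mulrA.
Qed.
Fact quo_mul1 : left_id quo_one quo_mul.
Proof. by move=> x; rewrite -[x]qreprK quo_mulE mul1r. Qed.
Fact quo_mulr1 : right_id quo_one quo_mul.
Proof. by move=> x; rewrite -[x]qreprK quo_mulE mulr1. Qed.
Fact quo_mulDl : left_distributive quo_mul +%R.
Proof.
move=> x y z; rewrite -[x]qreprK -[y]qreprK -[z]qreprK.
by rewrite -raddfD !quo_mulE mulrDl raddfD.
Qed.
Fact quo_mulDr : right_distributive quo_mul +%R.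
Proof.
move=> x y z; rewrite -[x]qreprK -[y]qreprK -[z]qreprK.
by rewrite -raddfD !quo_mulE mulrDr raddfD.
Qed.
HB.instance Definition _ := GRing.Zmodule_isPzRing.Build Q
  quo_mulA quo_mul1 quo_mulr1 quo_mulDl quo_mulDr.
Fact qpi_is_monoid_morphism : monoid_morphism qpi.
Proof. by split=> // a b; rewrite -quo_mulE. Qed.
HB.instance Definition _ := GRing.isMonoidMorphism.Build A Q qpi
  qpi_is_monoid_morphism.
End Ring.

Section Alg.
Variables (A : kalgType k) (I : ideal A).
Definition quo_scal (c : k) : quo_alg I := qpi I (scal c).
Fact quo_scal_zmod_morphism : zmod_morphism quo_scal.
Proof. by move=> c d; rewrite /quo_scal !rmorphB. Qed.
Fact quo_scal_monoid_morphism : monoid_morphism quo_scal.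
Proof. by split=> [|c d]; rewrite /quo_scal ?rmorph1 ?rmorphM. Qed.
Fact quo_scalC c (x : quo_alg I) : quo_scal c * x = x * quo_scal c.
Proof. by rewrite -[x]qreprK -!rmorphM scalC. Qed.
HB.instance Definition _ := PzRing_isScalarAlg.Build k (quo_alg I)
  quo_scal_zmod_morphism quo_scal_monoid_morphism quo_scalC.
End Alg.
End QuotientAlgebra.

(* Additive extension of h to finite formal sums. *)
Definition mext (K : choiceType) (G V : zmodType) (h : K -> G -> V)
    (f : {malg G[K]}) : V :=
  \sum_(x <- msupp f) h x (mcoeff x f).

Section AdditiveExtension.
Variables (K : choiceType) (G V : zmodType) (h : K -> G -> V).
Hypothesis hB : forall x, zmod_morphism (h x).
Let h0 x : h x 0 = 0. Proof. by have := hB x 0 0; rewrite !subr0 subrr. Qed.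
Lemma mext_wide (d : {fset K}) (f : {malg G[K]}) : (msupp f `<=` d)%fset ->
  mext h f = \sum_(x <- d) h x (mcoeff x f).
Proof.
move=> le_d; rewrite /mext (big_fset_incl _ le_d) //= => x _ /mcoeff_outdom ->.
exact: h0.
Qed.
Lemma mextB : zmod_morphism (mext h).
Proof.
move=> f g; pose d := (msupp f `|` msupp g)%fset.
rewrite (@mext_wide d (f - g)) ?msuppB_le // (@mext_wide d f) ?fsubsetUl //.
rewrite (@mext_wide d g) ?fsubsetUr // -sumrB.
by apply: eq_bigr => x _; rewrite mcoeffB hB.
Qed.
Lemma mextD : {morph mext h : f g / f + g}.
Proof.
have mN f : mext h (- f) = - mext h f.
  by rewrite -[- f]add0r mextB /mext msupp0 big_seq_fset0 sub0r.
by move=> f g; rewrite -[g in LHS]opprK mextB mN opprK.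
Qed.
Lemma mextU x c : mext h (mkmalgU x c) = h x c.
Proof.
by rewrite (@mext_wide [fset x]%fset) ?msuppU_le // big_seq_fset1 mcoeffUU.
Qed.
End AdditiveExtension.

Lemma malg_ind (K : choiceType) (G : zmodType) (P : {malg G[K]} -> Prop) :
  P 0 -> (forall f g, P f -> P g -> P (f + g)) ->
  (forall x c, P (mkmalgU x c)) -> forall f, P f.
Proof.
move=> P0 PD PU f; rewrite [f]monalgE.
by elim/big_ind: _ => // x _; apply: PU.
Qed.

(* M (x)_R N for a right R-action ra on M and a left R-action la on N: the
   free abelian group on M * N modulo biadditivity and balancedness. *)
Section Tensor.
Variables (R : Type) (M N : zmodType) (ra : M -> R -> M) (la : R -> N -> N).

Definition fgen (m : M) (n : N) : {malg int[(M * N)%type]} := mkmalgU (m, n) 1.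

Inductive tens_rel : {malg int[(M * N)%type]} -> Prop :=
| tens_rel0 : tens_rel 0
| tens_relB x y : tens_rel x -> tens_rel y -> tens_rel (x - y)
| tens_relDl m m' n : tens_rel (fgen (m + m') n - (fgen m n + fgen m' n))
| tens_relDr m n n' : tens_rel (fgen m (n + n') - (fgen m n + fgen m n'))
| tens_rel_bal m r n : tens_rel (fgen (ra m r) n - fgen m (la r n)).

Definition tens_sub := Subgroup tens_rel0 tens_relB.
Definition tensor : Type := quo tens_sub.
HB.instance Definition _ := GRing.Zmodule.on tensor.

Definition tens (m : M) (n : N) : tensor := quo_pi tens_sub (fgen m n).

(* The additive map tensor -> P induced by a balanced biadditive b. *)
Definition tlift (P : zmodType) (b : M -> N -> P) (t : tensor) : P :=
  mext (fun p (z : int) => b p.1 p.2 *~ z) (quo_repr t).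

Lemma tensDl m m' n : tens (m + m') n = tens m n + tens m' n.
Proof.
by rewrite /tens -[RHS](raddfD (quo_pi tens_sub)); apply/quo_piP/tens_relDl.
Qed.
Lemma tensDr m n n' : tens m (n + n') = tens m n + tens m n'.
Proof.
by rewrite /tens -[RHS](raddfD (quo_pi tens_sub)); apply/quo_piP/tens_relDr.
Qed.
Lemma tens_bal m r n : tens (ra m r) n = tens m (la r n).
Proof. exact/quo_piP/tens_rel_bal. Qed.

Lemma tensor_ind (P : tensor -> Prop) :
  (forall m n, P (tens m n)) -> (forall s t, P s -> P t -> P (s - t)) ->
  forall t, P t.
Proof.
move=> Pt PB t.
have P0 : P 0 by rewrite -(subrr (tens 0 0)); apply: PB.
have PN s : P s -> P (- s) by move=> Ps; rewrite -[- s]add0r; apply: PB.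
have PD s s' : P s -> P s' -> P (s + s').
  by move=> Ps Ps'; rewrite -[s']opprK; apply: PB => //; apply: PN.
have PMn s j : P s -> P (s *+ j).
  by move=> Ps; elim: j => [|j IHj]; rewrite ?mulr0n // mulrS; apply: PD.
rewrite -[t]quo_reprK; elim/malg_ind: (quo_repr t) => [|f g Pf Pg|[m n] z].
- by rewrite raddf0.
- by rewrite raddfD; apply: PD.
have -> : mkmalgU (m, n) z = fgen m n *~ z by rewrite -raddfMz /= intz.
rewrite raddfMz -/(tens m n); case: z => j; first exact/PMn/Pt.
by rewrite NegzE mulrNz; apply/PN/PMn/Pt.
Qed.

Section Lift.
Variables (P : zmodType) (b : M -> N -> P).
Hypothesis bDl : forall m m' n, b (m + m') n = b m n + b m' n.
Hypothesis bDr : forall m n n', b m (n + n') = b m n + b m n'.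
Hypothesis b_bal : forall m r n, b (ra m r) n = b m (la r n).
Let h (p : M * N) (z : int) : P := b p.1 p.2 *~ z.
Let hB p : zmod_morphism (h p). Proof. by move=> y z; rewrite /h mulrzBr. Qed.
Let h_fgen m n : mext h (fgen m n) = b m n. Proof. by rewrite mextU. Qed.
Let h_rel x : tens_rel x -> mext h x = 0.
Proof.
elim=> {x} [|x y _ h0x _ h0y|m m' n|m n n'|m r n].
- by have := mextB hB 0 0; rewrite !subrr.
- by rewrite (mextB hB) h0x h0y subrr.
- by rewrite (mextB hB) (mextD hB) !h_fgen bDl subrr.
- by rewrite (mextB hB) (mextD hB) !h_fgen bDr subrr.
by rewrite (mextB hB) !h_fgen b_bal subrr.
Qed.
Let tlift_pi x : tlift b (quo_pi tens_sub x) = mext h x.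
Proof.
apply/eqP; rewrite -subr_eq0 -(mextB hB); apply/eqP/h_rel.
by apply/(@quo_piP _ tens_sub); rewrite quo_reprK.
Qed.
Lemma tlift_tens m n : tlift b (tens m n) = b m n.
Proof. by rewrite tlift_pi h_fgen. Qed.
Lemma tlift_is_additive : zmod_morphism (tlift b).
Proof.
move=> s t; rewrite -[s]quo_reprK -[t]quo_reprK.
by rewrite -(raddfB (quo_pi tens_sub)) !tlift_pi (mextB hB).
Qed.
End Lift.
End Tensor.

Record alg_action (k : pzRingType) (A : kalgType k) (gT : finGroupType) :=
  AlgAction {
    aact :> gT -> A -> A;
    aact_zmod_morphism : forall g, zmod_morphism (aact g);
    aact_monoid_morphism : forall g, monoid_morphism (aact g);
    aact_scal : forall g (c : k), aact g (scal c) = scal c;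
    aact1 : forall a, aact 1%g a = a;
    aactM : forall g h a, aact (g * h)%g a = aact g (aact h a)
  }.

HB.instance Definition _ k A gT (act : @alg_action k A gT) g :=
  GRing.isZmodMorphism.Build A A (act g) (aact_zmod_morphism act g).
HB.instance Definition _ k A gT (act : @alg_action k A gT) g :=
  GRing.isMonoidMorphism.Build A A (act g) (aact_monoid_morphism act g).

Definition trivial_action (k : comNzRingType) (gT : finGroupType)
  : alg_action k^o gT.
Proof. by exists (fun _ => @idfun k). Defined.

(* The underlying space of the skew group algebra AG: f is \sum_g g (f g). *)
Definition skew_alg (k : pzRingType) (A : kalgType k) (gT : finGroupType)
  (act : alg_action A gT) (G : {group gT}) : Type := {ffun subg_of G -> A}.

Section Skew.
Variables (k : pzRingType) (A : kalgType k) (gT : finGroupType).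
Variables (act : alg_action A gT) (G : {group gT}).

Local Notation skew_alg := (skew_alg act G).
HB.instance Definition _ := GRing.Zmodule.on skew_alg.

(* The element g a. *)
Definition sk (g : subg_of G) (a : A) : skew_alg :=
  [ffun x => if x == g then a else 0].

Definition sk_one : skew_alg := sk 1%g 1.
Definition sk_mul (f1 f2 : skew_alg) : skew_alg :=
  [ffun x => \sum_(h : subg_of G)
     act (sgval h)^-1%g (f1 (x * h^-1)%g) * f2 h].

Fact sk_mulA : associative sk_mul.
Proof.
move=> f1 f2 f3; apply/ffunP => x; rewrite !ffunE.
under eq_bigr => m _ do rewrite ffunE mulr_sumr.
under [RHS]eq_bigr => h _ do rewrite ffunE raddf_sum mulr_suml.
rewrite exchange_big; apply: eq_bigr => h _.
rewrite (reindex_inj (mulIg h)); apply: eq_bigr => l _ /=.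
by rewrite mulgK !invMg mulgA rmorphM aactM mulrA.
Qed.
Fact sk_mul1 : left_id sk_one sk_mul.
Proof.
move=> f; apply/ffunP => x; rewrite ffunE (bigD1 x) //= big1 ?addr0 => [|h neq].
  by rewrite ffunE mulgV eqxx rmorph1 mul1r.
rewrite ffunE ifN ?rmorph0 ?mul0r //.
by apply: contraNneq neq => /(canRL (mulgKV h)); rewrite mul1g => ->.
Qed.
Fact sk_mulr1 : right_id sk_one sk_mul.
Proof.
move=> f; apply/ffunP => x; rewrite ffunE (bigD1 1%g) //= big1 => [|h neq].
  by rewrite ffunE eqxx mulr1 addr0 !invg1 mulg1 aact1.
by rewrite ffunE (negPf neq) mulr0.
Qed.
Fact sk_mulDl : left_distributive sk_mul +%R.
Proof.
move=> f1 f2 f3; apply/ffunP => x; rewrite !ffunE -big_split.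
by apply: eq_bigr => h _; rewrite ffunE rmorphD mulrDl.
Qed.
Fact sk_mulDr : right_distributive sk_mul +%R.
Proof.
move=> f1 f2 f3; apply/ffunP => x; rewrite !ffunE -big_split.
by apply: eq_bigr => h _; rewrite ffunE mulrDr.
Qed.
HB.instance Definition _ := GRing.Zmodule_isPzRing.Build skew_alg
  sk_mulA sk_mul1 sk_mulr1 sk_mulDl sk_mulDr.

Fact sk_is_additive g : zmod_morphism (sk g).
Proof.
by move=> a b; apply/ffunP => x; rewrite !ffunE; case: eqP; rewrite ?subrr.
Qed.
HB.instance Definition _ g := GRing.isZmodMorphism.Build A skew_alg (sk g)
  (sk_is_additive g).

Lemma sk_sum (f : skew_alg) : f = \sum_g sk g (f g).
Proof.
apply/ffunP => x; rewrite sum_ffunE (bigD1 x) //= big1 ?addr0 => [|g neq].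
  by rewrite ffunE eqxx.
by rewrite ffunE eq_sym (negPf neq).
Qed.

Lemma sk_mulE g h a b :
  sk g a * sk h b = sk (g * h)%g (act (sgval h)^-1%g a * b).
Proof.
apply/ffunP => x; rewrite ffunE (bigD1 h) //= big1 ?addr0 => [|h' neq].
  rewrite !ffunE eqxx -(inj_eq (mulIg h)) mulgKV.
  by case: eqP => // _; rewrite rmorph0 mul0r.
by rewrite [sk h b h']ffunE (negPf neq) mulr0.
Qed.

(* The inclusion of A, a |-> 1 a. *)
Definition sk_base (a : A) : skew_alg := sk 1%g a.
HB.instance Definition _ := GRing.isZmodMorphism.Build A skew_alg sk_base
  (sk_is_additive 1%g).
Fact sk_base_monoid_morphism : monoid_morphism sk_base.
Proof.
by split=> // a b; rewrite /sk_base sk_mulE mulg1 invg1 aact1.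
Qed.
HB.instance Definition _ := GRing.isMonoidMorphism.Build A skew_alg sk_base
  sk_base_monoid_morphism.

Definition sk_scal (c : k) : skew_alg := sk_base (scal c).
Fact sk_scal_zmod_morphism : zmod_morphism sk_scal.
Proof. by move=> c d; rewrite /sk_scal !rmorphB. Qed.
Fact sk_scal_monoid_morphism : monoid_morphism sk_scal.
Proof. by split=> [|c d]; rewrite /sk_scal ?rmorph1 ?rmorphM. Qed.
Fact sk_scalC c f : sk_scal c * f = f * sk_scal c.
Proof.
rewrite [f]sk_sum mulr_sumr mulr_suml; apply: eq_bigr => g _.
by rewrite !sk_mulE mul1g mulg1 aact_scal invg1 aact1 scalC.
Qed.
HB.instance Definition _ := PzRing_isScalarAlg.Build k skew_alg
  sk_scal_zmod_morphism sk_scal_monoid_morphism sk_scalC.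
End Skew.

Arguments sk {k A gT} act {G} g a.
Arguments sk_base {k A gT} act G _.

Definition group_alg (k : comNzRingType) (gT : finGroupType) (G : {group gT})
  : kalgType k := skew_alg (trivial_action k gT) G.

(* The map AH -> AG, ha |-> ha; [subg G (sgval h)] is h seen in G,
   which is meaningful for H \subset G. *)
Definition sk_incl (k : pzRingType) (A : kalgType k) (gT : finGroupType)
    (act : alg_action A gT) (G H : {group gT}) (f : skew_alg act H) : skew_alg act G :=
  \sum_(h : subg_of H) sk act (subg G (sgval h)) (f h).

Arguments sk_incl {k A gT} act G H _.

Lemma sk_incl_is_additive k A gT act G H : zmod_morphism (@sk_incl k A gT act G H).
Proof.
move=> f1 f2; rewrite /sk_incl -sumrB.
by apply: eq_bigr => h _; rewrite !ffunE raddfB.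
Qed.

Lemma iso_by (R : pzRingType) (M N : lmodType R) (f : M -> N) :
  linear f -> bijective f -> iso M N.
Proof.
move=> lin_f bij_f.
pose fL : {linear M -> N} := HB.pack f (GRing.isLinear.Build R M N *:%R f lin_f).
by exists fL.
Qed.

Section Twist.
Variables (k : pzRingType) (A : kalgType k) (gT : finGroupType).
Variables (act : alg_action A gT).

Definition twist (g : gT) (X : lmodType A) : lmodType A := res (act g^-1%g) X.

Definition g_invariant (G : {group gT}) (Y : lmodType A) : Prop :=
  forall g, g \in G -> iso (twist g Y) Y.

Definition indecomposable_g_invariant (G : {group gT}) (Y : lmodType A) : Prop :=
  [/\ ~ zero_mod Y, g_invariant G Y &
      forall N P : lmodType A, g_invariant G N -> g_invariant G P ->
        iso Y (N * P)%type -> zero_mod N \/ zero_mod P].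

Definition inertia_set (G : {group gT}) (X : lmodType A) : {set gT} :=
  [set g in G | `[< iso (twist g X) X >]].

Lemma inertia_group_set G X : group_set (inertia_set G X).
Proof.
apply/group_setP; split=> [|g h].
  rewrite inE group1; apply/asboolP; apply: (@iso_by _ (twist 1%g X) X idfun).
    move=> a x y /=; congr (_ + y).
    by rewrite [LHS]/(_ *: (x : X)) /= invg1 aact1.
  by exists idfun.
rewrite !inE => /andP[Gg /asboolP[u bij_u]] /andP[Gh /asboolP[v bij_v]].
rewrite groupM //; apply/asboolP.
apply: (@iso_by _ (twist (g * h)%g X) X (u \o v)); last exact: bij_comp.
move=> a x y /=.
transitivity (u (v (act g^-1%g a *: (x : twist h X) + (y : twist h X)))).
  congr (u (v (_ + _))); rewrite -[LHS]/(act (g * h)^-1%g a *: (x : X)).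
  by rewrite invMg aactM.
rewrite linearP; exact: (linearP u a (v x) (v y)).
Qed.
Canonical inertia (G : {group gT}) (X : lmodType A) : {group gT} :=
  Group (inertia_group_set G X).
End Twist.

Section Induced.
Variables (k : pzRingType) (A : kalgType k) (gT : finGroupType).
Variables (act : alg_action A gT) (G H : {group gT}) (N : lmodType (skew_alg act H)).
Local Notation S := (skew_alg act G).

Definition ind_ra (s : S) (r : skew_alg act H) : S := s * sk_incl act G H r.
Definition ind_la (r : skew_alg act H) (n : N) : N := r *: n.

Definition induced : Type := tensor ind_ra ind_la.
HB.instance Definition _ := GRing.Zmodule.on induced.
Definition itens (s : S) (n : N) : induced := tens ind_ra ind_la s n.

Lemma induced_ind (P : induced -> Prop) :
  (forall s n, P (itens s n)) -> (forall t u, P t -> P u -> P (t - u)) ->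
  forall t, P t.
Proof. exact: tensor_ind. Qed.

Definition ind_scale (s : S) (t : induced) : induced :=
  tlift (fun s' n => itens (s * s') n) t.

Fact ind_bDl s m m' n : itens (s * (m + m')) n = itens (s * m) n + itens (s * m') n.
Proof. by rewrite mulrDr; apply: tensDl. Qed.
Fact ind_bDr s m n n' : itens (s * m) (n + n') = itens (s * m) n + itens (s * m) n'.
Proof. exact: tensDr. Qed.
Fact ind_bal s m r n : itens (s * ind_ra m r) n = itens (s * m) (ind_la r n).
Proof. by rewrite /ind_ra mulrA; apply: tens_bal. Qed.

Lemma ind_scale_tens s m n : ind_scale s (itens m n) = itens (s * m) n.
Proof. exact: (tlift_tens (ind_bDl s) (ind_bDr s) (ind_bal s)). Qed.
Lemma ind_scale_additive s : zmod_morphism (ind_scale s).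
Proof. exact: (tlift_is_additive (ind_bDl s) (ind_bDr s) (ind_bal s)). Qed.
HB.instance Definition _ s := GRing.isZmodMorphism.Build induced induced
  (ind_scale s) (ind_scale_additive s).

Fact ind_scalerA a b t : ind_scale a (ind_scale b t) = ind_scale (a * b) t.
Proof.
elim/induced_ind: t => [m n|s t hs ht]; last by rewrite !raddfB /= hs ht.
by rewrite !ind_scale_tens mulrA.
Qed.
Fact ind_scale1r : left_id 1 ind_scale.
Proof.
elim/induced_ind => [m n|s t hs ht]; last by rewrite raddfB /= hs ht.
by rewrite ind_scale_tens mul1r.
Qed.
Fact ind_scalerDr : right_distributive ind_scale +%R.
Proof. by move=> a s t; rewrite raddfD. Qed.
Fact ind_scalerDl t : {morph ind_scale^~ t : a b / a + b}.
Proof.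
move=> a b; elim/induced_ind: t => [m n|s t hs ht].
  by rewrite !ind_scale_tens mulrDl; apply: tensDl.
by rewrite !raddfB /= hs ht opprD !addrA; congr (_ - _); rewrite addrAC.
Qed.
HB.instance Definition _ := GRing.Zmodule_isLmodule.Build S induced
  ind_scalerA ind_scale1r ind_scalerDr ind_scalerDl.
End Induced.

Section TensorRep.
Variables (k : comNzRingType) (A : kalgType k) (gT : finGroupType).
Variables (act : alg_action A gT) (H : {group gT}).
Variables (L : lmodType (group_alg k H)) (N : lmodType (skew_alg act H)).
Local Notation kact := (trivial_action k gT).

Definition rep_ra (l : L) (c : k) : L := (scal c : group_alg k H) *: l.
Definition rep_la (c : k) (x : N) : N := (scal c : skew_alg act H) *: x.

Definition rep_tensor : Type := tensor rep_ra rep_la.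
HB.instance Definition _ := GRing.Zmodule.on rep_tensor.
Definition rtens (l : L) (x : N) : rep_tensor := tens rep_ra rep_la l x.

Lemma rep_tensor_ind (P : rep_tensor -> Prop) :
  (forall l x, P (rtens l x)) -> (forall t u, P t -> P u -> P (t - u)) ->
  forall t, P t.
Proof. exact: tensor_ind. Qed.

(* ga (l (x) x) = g l (x) g a x, extended additively to f = \sum_g g (f g). *)
Definition rep_bilin (f : skew_alg act H) (l : L) (x : N) : rep_tensor :=
  \sum_(g : subg_of H) rtens (sk kact g 1 *: l) (sk act g (f g) *: x).
Definition rep_scale (f : skew_alg act H) (t : rep_tensor) : rep_tensor :=
  tlift (rep_bilin f) t.

Fact rep_bDl f m m' n : rep_bilin f (m + m') n = rep_bilin f m n + rep_bilin f m' n.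
Proof.
rewrite /rep_bilin -big_split; apply: eq_bigr => g _.
by rewrite scalerDr; apply: tensDl.
Qed.
Fact rep_bDr f m n n' : rep_bilin f m (n + n') = rep_bilin f m n + rep_bilin f m n'.
Proof.
rewrite /rep_bilin -big_split; apply: eq_bigr => g _.
by rewrite scalerDr; apply: tensDr.
Qed.
Fact rep_bal f m r n : rep_bilin f (rep_ra m r) n = rep_bilin f m (rep_la r n).
Proof.
apply: eq_bigr => g _; rewrite /rep_ra /rep_la !scalerA -!scalC -!scalerA.
exact: tens_bal.
Qed.
Lemma rep_scale_tens f m n : rep_scale f (rtens m n) = rep_bilin f m n.
Proof. exact: (tlift_tens (rep_bDl f) (rep_bDr f) (rep_bal f)). Qed.
Lemma rep_scale_additive f : zmod_morphism (rep_scale f).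
Proof. exact: (tlift_is_additive (rep_bDl f) (rep_bDr f) (rep_bal f)). Qed.
HB.instance Definition _ f := GRing.isZmodMorphism.Build rep_tensor rep_tensor
  (rep_scale f) (rep_scale_additive f).

Fact rtens_additive m : zmod_morphism (rtens m).
Proof.
move=> x y; apply/eqP; rewrite eq_sym subr_eq -[rtens _ _ + _]tensDr.
by rewrite subrK.
Qed.
HB.instance Definition _ m := GRing.isZmodMorphism.Build N rep_tensor (rtens m)
  (rtens_additive m).

Lemma rep_scale_sk g a l x :
  rep_scale (sk act g a) (rtens l x) = rtens (sk kact g 1 *: l) (sk act g a *: x).
Proof.
rewrite rep_scale_tens /rep_bilin (bigD1 g) //= big1 ?addr0 => [|h neq].
  by rewrite ffunE eqxx.
by rewrite ffunE (negPf neq) raddf0 scale0r raddf0.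
Qed.

Fact rep_scalerDl t : {morph rep_scale^~ t : a b / a + b}.
Proof.
move=> a b; elim/rep_tensor_ind: t => [m n|s t hs ht].
  rewrite !rep_scale_tens /rep_bilin -big_split.
  by apply: eq_bigr => g _; rewrite ffunE raddfD scalerDl raddfD.
by rewrite !raddfB /= hs ht opprD !addrA; congr (_ - _); rewrite addrAC.
Qed.
Fact rep_scale0 t : rep_scale 0 t = 0.
Proof. by apply: (addrI (rep_scale 0 t)); rewrite -rep_scalerDl !addr0. Qed.
Fact rep_scale_sum (F : subg_of H -> skew_alg act H) t :
  rep_scale (\sum_g F g) t = \sum_g rep_scale (F g) t.
Proof.
exact: (big_morph (rep_scale^~ t) (rep_scalerDl t) (rep_scale0 t)).
Qed.

Fact rep_scalerA a b t : rep_scale a (rep_scale b t) = rep_scale (a * b) t.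
Proof.
elim/rep_tensor_ind: t => [m n|s t hs ht]; last by rewrite !raddfB /= hs ht.
rewrite [a]sk_sum [b]sk_sum mulr_suml !rep_scale_sum.
apply: eq_bigr => g _; rewrite raddf_sum mulr_sumr rep_scale_sum /=.
apply: eq_bigr => h _.
by rewrite !rep_scale_sk sk_mulE rep_scale_sk -sk_mulE -!scalerA !scalerA !sk_mulE mulr1.
Qed.
Fact rep_scale1r : left_id 1 rep_scale.
Proof.
elim/rep_tensor_ind => [m n|s t hs ht]; last by rewrite raddfB /= hs ht.
by rewrite rep_scale_sk !scale1r.
Qed.
Fact rep_scalerDr : right_distributive rep_scale +%R.
Proof. by move=> a s t; rewrite raddfD. Qed.
HB.instance Definition _ := GRing.Zmodule_isLmodule.Build (skew_alg act H) rep_tensor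
  rep_scalerA rep_scale1r rep_scalerDr rep_scalerDl.
End TensorRep.

Record quiver := Quiver {
  vert : finType;
  arr : finType;
  src : arr -> vert;
  tgt : arr -> vert
}.

Section Paths.
Variable Q : quiver.

Fixpoint walk (v : vert Q) (s : seq (arr Q)) : bool :=
  if s is e :: s' then (src e == v) && walk (tgt e) s' else true.

(* A path: its source and its arrows, in the order of traversal; (v, [::]) is
   the trivial path at v. *)
Record qpath := QPath {
  qpath_val : vert Q * seq (arr Q);
  _ : walk qpath_val.1 qpath_val.2
}.
HB.instance Definition _ := [isSub for qpath_val].
(* These instances are opaque because unfolding them during unification is
   prohibitively slow. *)
Fact qpath_hasDecEq : hasDecEq qpath.
Proof. by exists (fun p q => qpath_val p == qpath_val q) => p q; apply: val_eqP. Qed.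
HB.instance Definition _ := qpath_hasDecEq.
Fact qpath_hasChoice : hasChoice qpath.
Proof. exact: (@PCanHasChoice _ _ val insub valK). Qed.
HB.instance Definition _ := qpath_hasChoice.

Definition psrc (p : qpath) : vert Q := (val p).1.
Definition ptgt (p : qpath) : vert Q := last (psrc p) (map (@tgt Q) (val p).2).
Definition ptriv (v : vert Q) : qpath := @QPath (v, [::]) isT.

(* "q, then p"; only meaningful when ptgt q = psrc p. *)
Definition pcat (p q : qpath) : qpath :=
  insubd q (psrc q, (val q).2 ++ (val p).2).

Lemma walk_cat v s t :
  walk v (s ++ t) = walk v s && walk (last v (map (@tgt Q) s)) t.
Proof. by elim: s v => //= e s IHs v; rewrite IHs andbA. Qed.

Lemma val_pcat p q : ptgt q = psrc p ->
  val (pcat p q) = (psrc q, (val q).2 ++ (val p).2).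
Proof.
move=> eq_qp; rewrite /pcat insubdK // unfold_in /= walk_cat.
have -> : walk (psrc q) (val q).2 by exact: (valP q).
by rewrite -/(ptgt q) eq_qp; exact: (valP p).
Qed.
Lemma psrc_pcat p q : ptgt q = psrc p -> psrc (pcat p q) = psrc q.
Proof. by move=> eq_qp; rewrite /psrc val_pcat. Qed.
Lemma ptgt_pcat p q : ptgt q = psrc p -> ptgt (pcat p q) = ptgt p.
Proof.
move=> eq_qp; rewrite /ptgt /psrc val_pcat //= map_cat last_cat.
by rewrite -/(psrc q) -/(ptgt q) eq_qp.
Qed.
Lemma pcatA p q r : ptgt r = psrc q -> ptgt q = psrc p ->
  pcat p (pcat q r) = pcat (pcat p q) r.
Proof.
move=> eq_rq eq_qp; apply: val_inj.
by rewrite !val_pcat ?psrc_pcat ?ptgt_pcat // catA.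
Qed.
Lemma pcat_trivl p : pcat (ptriv (ptgt p)) p = p.
Proof.
by apply: val_inj; rewrite val_pcat //= cats0 /psrc /=; case: (qpath_val p).
Qed.
Lemma pcat_trivr p : pcat p (ptriv (psrc p)) = p.
Proof.
by apply: val_inj; rewrite val_pcat //= /psrc /=; case: (qpath_val p).
Qed.
End Paths.

(* The path algebra kQ, with pq meaning "q, then p", so that left kQ-modules
   are representations of Q. *)
Definition path_alg (k : fieldType) (Q : quiver) : Type := {malg k[qpath Q]}.

Section PathAlgebra.
Variables (k : fieldType) (Q : quiver).
Local Notation KQ := (path_alg k Q).
HB.instance Definition _ := GRing.Lmodule.on KQ.

Definition pbase (p : qpath Q) : KQ := mkmalgU p 1.
Definition pmul (p q : qpath Q) : KQ :=
  if ptgt q == psrc p then pbase (pcat p q) else 0.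

Lemma path_alg_ind (P : KQ -> Prop) :
  P 0 -> (forall f g, P f -> P g -> P (f + g)) ->
  (forall p c, P (mkmalgU p c)) -> forall f, P f.
Proof. exact: malg_ind. Qed.

Definition pa_one : KQ := \sum_(v : vert Q) pbase (ptriv v).
Definition pa_mul (f g : KQ) : KQ :=
  \sum_(p <- msupp f) \sum_(q <- msupp g) (mcoeff p f * mcoeff q g) *: pmul p q.

Lemma pa_mulEl f g : pa_mul f g =
  mext (fun p c => mext (fun q d => (c * d) *: pmul p q) g) f.
Proof. by []. Qed.
Lemma pa_mulEr f g : pa_mul f g =
  mext (fun q d => mext (fun p c => (c * d) *: pmul p q) f) g.
Proof. by rewrite /pa_mul exchange_big. Qed.

Fact pa_inner_r p c : forall q, zmod_morphism (fun d => (c * d) *: pmul p q).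
Proof. by move=> q x y; rewrite mulrBr scalerBl. Qed.
Fact pa_inner_l q d : forall p, zmod_morphism (fun c => (c * d) *: pmul p q).
Proof. by move=> p x y; rewrite mulrBl scalerBl. Qed.
Fact pa_outer_l g p :
  zmod_morphism (fun c => mext (fun q d => (c * d) *: pmul p q) g).
Proof.
move=> x y; rewrite /mext -sumrB; apply: eq_bigr => q _.
by rewrite mulrBl scalerBl.
Qed.
Fact pa_outer_r f q :
  zmod_morphism (fun d => mext (fun p c => (c * d) *: pmul p q) f).
Proof.
move=> x y; rewrite /mext -sumrB; apply: eq_bigr => p _.
by rewrite mulrBr scalerBl.
Qed.

Fact pa_mulDl : left_distributive pa_mul +%R.
Proof. by move=> f g h; rewrite !pa_mulEl (mextD (pa_outer_l h)). Qed.
Fact pa_mulDr : right_distributive pa_mul +%R.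
Proof. by move=> f g h; rewrite !pa_mulEr (mextD (pa_outer_r f)). Qed.
Fact pa_mul0 f : pa_mul f 0 = 0.
Proof. by rewrite pa_mulEr /mext msupp0 big_seq_fset0. Qed.
Fact pa_0mul f : pa_mul 0 f = 0.
Proof. by rewrite pa_mulEl /mext msupp0 big_seq_fset0. Qed.
Lemma pa_mulUU p q c d :
  pa_mul (mkmalgU p c) (mkmalgU q d) = (c * d) *: pmul p q.
Proof.
by rewrite pa_mulEl (mextU (pa_outer_l _)) (mextU (pa_inner_r p c)).
Qed.
Lemma scale_mono (c d : k) (p : qpath Q) :
  c *: (mkmalgU p d : KQ) = mkmalgU p (c * d).
Proof.
apply/malgP => r; apply: etrans (mcoeffZ c (mkmalgU p d) r) _.
by rewrite (mcoeffU p d r) (mcoeffU p (c * d) r) mulrnAr.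
Qed.
Lemma scale_pbase c p : c *: pbase p = mkmalgU p c.
Proof. by rewrite [LHS](scale_mono c 1 p) mulr1. Qed.

Fact pa_mulA : associative pa_mul.
Proof.
move=> f g h; elim/path_alg_ind: f => [|f f' If If'|p c].
- by rewrite (pa_0mul (pa_mul g h)) (pa_0mul g) (pa_0mul h).
- by rewrite (pa_mulDl f f') (pa_mulDl f f') (pa_mulDl _ _ h) If If'.
elim/path_alg_ind: g => [|g g' Ig Ig'|q d].
- by rewrite (pa_0mul h) (pa_mul0 (mkmalgU p c)) (pa_0mul h).
- by rewrite (pa_mulDl g g' h) (pa_mulDr (mkmalgU p c)) (pa_mulDr (mkmalgU p c))
     (pa_mulDl _ _ h) Ig Ig'.
elim/path_alg_ind: h => [|h h' Ih Ih'|r e].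
- by rewrite (pa_mul0 (mkmalgU q d)) (pa_mul0 (mkmalgU p c))
     (pa_mul0 (pa_mul _ _)).
- by rewrite (pa_mulDr (mkmalgU q d)) (pa_mulDr (mkmalgU p c))
     (pa_mulDr (pa_mul _ _)) Ih Ih'.
rewrite (pa_mulUU q r d e) (pa_mulUU p q c d) /pmul.
case: (eqVneq (ptgt r) (psrc q)) => [eq_rq|neq_rq];
  case: (eqVneq (ptgt q) (psrc p)) => [eq_qp|neq_qp].
- rewrite (scale_pbase (d * e)) (scale_pbase (c * d)).
  rewrite (pa_mulUU p (pcat q r) c (d * e)) (pa_mulUU (pcat p q) r (c * d) e) /pmul psrc_pcat // ptgt_pcat //.
  by rewrite eq_rq eq_qp !eqxx pcatA // mulrA.
- rewrite (scale_pbase (d * e)) (scaler0 _ (c * d)) (pa_0mul (mkmalgU r e)).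
  by rewrite (pa_mulUU p (pcat q r) c (d * e)) /pmul ptgt_pcat // (negPf neq_qp) scaler0.
- rewrite (scale_pbase (c * d)) (scaler0 _ (d * e)) (pa_mul0 (mkmalgU p c)).
  by rewrite (pa_mulUU (pcat p q) r (c * d) e) /pmul psrc_pcat // (negPf neq_rq) scaler0.
rewrite (scaler0 _ (c * d)) (scaler0 _ (d * e)).
by rewrite (pa_mul0 (mkmalgU p c)) (pa_0mul (mkmalgU r e)).
Qed.

Fact pa_mul_suml (I : finType) (F : I -> KQ) g :
  pa_mul (\sum_i F i) g = \sum_i pa_mul (F i) g.
Proof. exact: (big_morph (pa_mul^~ g) (fun x y => pa_mulDl x y g) (pa_0mul g)). Qed.
Fact pa_mul_sumr (I : finType) (F : I -> KQ) g :
  pa_mul g (\sum_i F i) = \sum_i pa_mul g (F i).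
Proof. exact: (big_morph (pa_mul g) (pa_mulDr g) (pa_mul0 g)). Qed.

Fact pa_mul1 : left_id pa_one pa_mul.
Proof.
move=> f; elim/path_alg_ind: f => [|f f' If If'|p c]; rewrite ?pa_mul0 //.
  by rewrite pa_mulDr If If'.
rewrite /pa_one pa_mul_suml (bigD1 (ptgt p)) //= big1 ?addr0 => [|v neq].
  by rewrite pa_mulUU /pmul eqxx pcat_trivl scale_pbase mul1r.
by rewrite pa_mulUU /pmul /psrc /= eq_sym (negPf neq) scaler0.
Qed.
Fact pa_mulr1 : right_id pa_one pa_mul.
Proof.
move=> f; elim/path_alg_ind: f => [|f f' If If'|p c]; rewrite ?pa_0mul //.
  by rewrite pa_mulDl If If'.
rewrite /pa_one pa_mul_sumr (bigD1 (psrc p)) //= big1 ?addr0 => [|v neq].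
  by rewrite pa_mulUU /pmul eqxx pcat_trivr scale_pbase mulr1.
by rewrite pa_mulUU /pmul /ptgt /= (negPf neq) scaler0.
Qed.
HB.instance Definition _ := GRing.Zmodule_isPzRing.Build KQ
  pa_mulA pa_mul1 pa_mulr1 pa_mulDl pa_mulDr.

Fact pa_scaleAl c (f g : KQ) : (c *: f) * g = c *: (f * g).
Proof.
elim/path_alg_ind: f => [|f f' If If'|p b]; first by rewrite scaler0 !mul0r scaler0.
  by rewrite scalerDr !mulrDl If If' scalerDr.
elim/path_alg_ind: g => [|g g' Ig Ig'|q d]; first by rewrite !mulr0 scaler0.
  by rewrite !mulrDr Ig Ig' scalerDr.
rewrite (scale_mono c b p); apply: etrans (pa_mulUU p q (c * b) d) _.
apply: etrans (esym (congr1 (GRing.scale c) (pa_mulUU p q b d))).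
by rewrite scalerA mulrA.
Qed.
Fact pa_scaleAr c (f g : KQ) : f * (c *: g) = c *: (f * g).
Proof.
elim/path_alg_ind: f => [|f f' If If'|p b]; first by rewrite !mul0r scaler0.
  by rewrite !mulrDl If If' scalerDr.
elim/path_alg_ind: g => [|g g' Ig Ig'|q d].
- by rewrite scaler0 !mulr0 scaler0.
- by rewrite scalerDr !mulrDr Ig Ig' scalerDr.
rewrite (scale_mono c d q); apply: etrans (pa_mulUU p q b (c * d)) _.
apply: etrans (esym (congr1 (GRing.scale c) (pa_mulUU p q b d))).
by rewrite scalerA mulrCA.
Qed.

Definition pa_scal (c : k) : KQ := c *: (1 : KQ).
Fact pa_scal_zmod_morphism : zmod_morphism pa_scal.
Proof. by move=> c d; rewrite /pa_scal scalerBl. Qed.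
Fact pa_scal_monoid_morphism : monoid_morphism pa_scal.
Proof.
by split=> [|c d]; rewrite /pa_scal ?scale1r // pa_scaleAl mul1r scalerA.
Qed.
Fact pa_scalC c f : pa_scal c * f = f * pa_scal c.
Proof. by rewrite /pa_scal pa_scaleAl pa_scaleAr mul1r mulr1. Qed.
HB.instance Definition _ := PzRing_isScalarAlg.Build k KQ
  pa_scal_zmod_morphism pa_scal_monoid_morphism pa_scalC.
End PathAlgebra.

Section QuiverAut.
Variable Q : quiver.

Record qaut := QAut {
  qaut_val : {perm vert Q} * {perm arr Q};
  _ : [forall e, (src (qaut_val.2 e) == qaut_val.1 (src e)) &&
                 (tgt (qaut_val.2 e) == qaut_val.1 (tgt e))]
}.
HB.instance Definition _ := [isSub for qaut_val].
HB.instance Definition _ := [Finite of qaut by <:].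

Lemma qautP (a : qaut) e : src ((val a).2 e) = (val a).1 (src e) /\
  tgt ((val a).2 e) = (val a).1 (tgt e).
Proof. by have /forallP/(_ e)/andP[/eqP-> /eqP->] := valP a. Qed.

(* The group law is composition of maps, a * b = "b, then a", which is opposite
   to the law of {perm T}. *)
Fact qaut_mul_subproof (a b : qaut) :
  let c := ((val b).1 * (val a).1, (val b).2 * (val a).2)%g in
  [forall e, (src (c.2 e) == c.1 (src e)) && (tgt (c.2 e) == c.1 (tgt e))].
Proof.
apply/forallP => e; rewrite !permM.
by have [-> ->] := qautP a ((val b).2 e); have [-> ->] := qautP b e; rewrite !eqxx.
Qed.
Definition qaut_mul a b := QAut (qaut_mul_subproof a b).
Fact qaut_one_subproof : let c := (1, 1)%g : {perm vert Q} * {perm arr Q} in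
  [forall e, (src (c.2 e) == c.1 (src e)) && (tgt (c.2 e) == c.1 (tgt e))].
Proof. by apply/forallP => e; rewrite !perm1 !eqxx. Qed.
Definition qaut_one := QAut qaut_one_subproof.
Fact qaut_inv_subproof (a : qaut) :
  let c := ((val a).1^-1, (val a).2^-1)%g in
  [forall e, (src (c.2 e) == c.1 (src e)) && (tgt (c.2 e) == c.1 (tgt e))].
Proof.
apply/forallP => e /=; have [] := qautP a ((val a).2^-1%g e).
by rewrite permKV => -> ->; rewrite !permK !eqxx.
Qed.
Definition qaut_inv a := QAut (qaut_inv_subproof a).
Fact qaut_mulA : associative qaut_mul.
Proof. by move=> a b c; apply: val_inj; rewrite /= !mulgA. Qed.
Fact qaut_mul1 : left_id qaut_one qaut_mul.
Proof.
by move=> a; apply: val_inj; rewrite /= !mulg1; case: (qaut_val a).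
Qed.
Fact qaut_mulV : left_inverse qaut_one qaut_inv qaut_mul.
Proof. by move=> a; apply: val_inj; rewrite /= !mulgV. Qed.
HB.instance Definition _ := Finite_isGroup.Build qaut
  qaut_mulA qaut_mul1 qaut_mulV.

Definition qaut_vert (a : qaut) : vert Q -> vert Q := (val a).1.
Definition qaut_arr (a : qaut) : arr Q -> arr Q := (val a).2.

Fact qaut_path_subproof (a : qaut) (p : qpath Q) :
  walk (qaut_vert a (psrc p)) (map (qaut_arr a) (val p).2).
Proof.
case: p => [[v s]] /=; rewrite /psrc /=; elim: s v => //= e s IHs v.
case/andP=> /eqP <- /IHs; rewrite /qaut_arr /qaut_vert.
by have [-> ->] := qautP a e; rewrite eqxx.
Qed.
Definition qaut_path (a : qaut) (p : qpath Q) : qpath Q :=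
  @QPath Q (_, _) (qaut_path_subproof a p).

Lemma ptgt_qaut a p : ptgt (qaut_path a p) = qaut_vert a (ptgt p).
Proof.
rewrite /ptgt /=; rewrite [psrc (qaut_path _ _)]/(qaut_vert a (psrc p)).
rewrite -map_comp -(last_map (qaut_vert a)) -map_comp; congr last.
by apply: eq_map => e /=; case: (qautP a e).
Qed.
Lemma qaut_path_cat a p q : ptgt q = psrc p ->
  qaut_path a (pcat p q) = pcat (qaut_path a p) (qaut_path a q).
Proof.
move=> eq_qp; apply: val_inj; rewrite val_pcat; last first.
  by rewrite ptgt_qaut eq_qp.
by rewrite /= psrc_pcat // val_pcat //= map_cat.
Qed.
End QuiverAut.

Section QuiverAutAction.
Variables (k : fieldType) (Q : quiver).
Local Notation KQ := (path_alg k Q).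

(* The k-linear extension of the action on paths. *)
Definition qaut_alg (a : qaut Q) (f : KQ) : KQ :=
  \sum_(p <- msupp f) mkmalgU (qaut_path a p) (mcoeff p f).

Let h a (p : qpath Q) (c : k) : KQ := mkmalgU (qaut_path a p) c.
Let hB a p : zmod_morphism (h a p).
Proof. by move=> c d; rewrite /h raddfB. Qed.

Fact qaut_alg_zmod_morphism a : zmod_morphism (qaut_alg a).
Proof. exact: (mextB (hB a)). Qed.
HB.instance Definition _ a := GRing.isZmodMorphism.Build KQ KQ (qaut_alg a)
  (qaut_alg_zmod_morphism a).
Lemma qaut_algU a p c : qaut_alg a (mkmalgU p c) = mkmalgU (qaut_path a p) c.
Proof. exact: (mextU (hB a)). Qed.

Lemma qaut_algZ a c f : qaut_alg a (c *: f) = c *: qaut_alg a f.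
Proof.
elim/path_alg_ind: f => [|f f' If If'|p b]; first by rewrite scaler0 raddf0 scaler0.
  by rewrite scalerDr !raddfD /= If If'.
rewrite (scale_mono c b p) (qaut_algU a p (c * b)) (qaut_algU a p b).
by rewrite (scale_mono c b (qaut_path a p)).
Qed.
Lemma qaut_algM a : {morph qaut_alg a : f g / f * g}.
Proof.
move=> f g; elim/path_alg_ind: f => [|f f' If If'|p c].
- by rewrite raddf0 !mul0r raddf0.
- by rewrite raddfD !mulrDl raddfD /= If If'.
elim/path_alg_ind: g => [|g g' Ig Ig'|q d].
- by rewrite raddf0 !mulr0 raddf0.
- by rewrite raddfD !mulrDr raddfD /= Ig Ig'.
rewrite (qaut_algU a p c) (qaut_algU a q d).
apply: etrans (congr1 (qaut_alg a) (pa_mulUU p q c d)) _.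
apply: etrans (esym (pa_mulUU (qaut_path a p) (qaut_path a q) c d)).
rewrite qaut_algZ; congr (_ *: _).
rewrite /pmul ptgt_qaut [psrc (qaut_path _ _)]/(qaut_vert a (psrc p)).
rewrite (inj_eq perm_inj); case: eqP => [eq_qp|_]; last by rewrite raddf0.
by rewrite qaut_algU qaut_path_cat.
Qed.
Lemma qaut_alg_one a : qaut_alg a 1 = 1.
Proof.
rewrite [1]/(pa_one k Q) /pa_one raddf_sum.
rewrite [RHS](reindex_inj (@perm_inj _ (val a).1)); apply: eq_bigr => v _.
apply: etrans (qaut_algU a (ptriv v) 1) _.
by congr (mkmalgU _ 1); apply: val_inj.
Qed.
Lemma qaut_alg1 f : qaut_alg 1%g f = f.
Proof.
elim/path_alg_ind: f => [|f f' If If'|p c]; first by rewrite raddf0.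
  by rewrite raddfD /= If If'.
apply: etrans (qaut_algU 1%g p c) _; congr (mkmalgU _ c); apply: val_inj.
rewrite /= /psrc.
have e1 : qaut_vert (1%g : qaut Q) =1 id by move=> v; exact: perm1.
have e2 : qaut_arr (1%g : qaut Q) =1 id by move=> v; exact: perm1.
by rewrite e1 (eq_map e2) map_id /=; case: (qpath_val p).
Qed.
Lemma qaut_algMg a b f : qaut_alg (a * b)%g f = qaut_alg a (qaut_alg b f).
Proof.
elim/path_alg_ind: f => [|f f' If If'|p c]; first by rewrite !raddf0.
  by rewrite !raddfD /= If If'.
rewrite (qaut_algU b p c) (qaut_algU a _ c) (qaut_algU _ p c).
congr (mkmalgU _ c); apply: val_inj; rewrite /=.
have e1 : qaut_vert (a * b)%g =1 qaut_vert a \o qaut_vert b.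
  by move=> v; exact: permM.
have e2 : qaut_arr (a * b)%g =1 qaut_arr a \o qaut_arr b.
  by move=> v; exact: permM.
by rewrite e1 (eq_map e2) map_comp.
Qed.

(* Aut(Q, I): the automorphisms a with a(I) = I. *)
Definition autQI_set (I : ideal KQ) : {set qaut Q} :=
  [set a | `[< forall g, I g <-> exists2 f, I f & qaut_alg a f = g >]].
Lemma autQI_group_set I : group_set (autQI_set I).
Proof.
apply/group_setP; split=> [|a b].
  rewrite inE; apply/asboolP => g; split=> [Ig|[f If <-]]; last by rewrite qaut_alg1.
  by exists g => //; rewrite qaut_alg1.
rewrite !inE => /asboolP Ia /asboolP Ib; apply/asboolP => g; split.
  case/Ia=> f /Ib[f' If' <-] <-; exists f' => //.
  by rewrite qaut_algMg.
case=> f If <-; rewrite qaut_algMg; apply/Ia; exists (qaut_alg b f) => //.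
by apply/Ib; exists f.
Qed.
Canonical autQI (I : ideal KQ) : {group qaut Q} := Group (autQI_group_set I).

Definition bound_alg (I : ideal KQ) : kalgType k := quo_alg I.

Section Quotient.
Variable I : ideal KQ.
Local Notation qI := (qpi I).
Definition autQI_act (a : subg_of (autQI I)) (x : bound_alg I) : bound_alg I :=
  qI (qaut_alg (sgval a) (qrepr x)).
Lemma autQI_actE a f : autQI_act a (qI f) = qI (qaut_alg (sgval a) f).
Proof.
apply/qpiP; rewrite -raddfB; have := subgP a; rewrite inE => /asboolP ->.
by exists (qrepr (qI f) - f) => //; apply/qpiP; rewrite qreprK.
Qed.
Fact autQI_act_zmod_morphism a : zmod_morphism (autQI_act a).
Proof.
move=> x y; rewrite -[x]qreprK -[y]qreprK -raddfB !autQI_actE.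
by rewrite !raddfB.
Qed.
Fact autQI_act_monoid_morphism a : monoid_morphism (autQI_act a).
Proof.
split=> [|x y]; first by rewrite -(rmorph1 qI) autQI_actE qaut_alg_one.
by rewrite -[x]qreprK -[y]qreprK -rmorphM !autQI_actE qaut_algM rmorphM.
Qed.
Fact autQI_act_scal a (c : k) : autQI_act a (scal c) = scal c.
Proof.
by rewrite [scal c]/(qI (c *: (1 : KQ))) autQI_actE qaut_algZ qaut_alg_one.
Qed.
Fact autQI_act1 x : autQI_act 1%g x = x.
Proof.
rewrite -[x]qreprK autQI_actE; apply: congr1; exact: (qaut_alg1 (qrepr x)).
Qed.
Fact autQI_actM a b x : autQI_act (a * b)%g x = autQI_act a (autQI_act b x).
Proof.
rewrite -[x]qreprK (autQI_actE b) (autQI_actE a) (autQI_actE (a * b)%g).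
apply: congr1; exact: (qaut_algMg (sgval a) (sgval b) (qrepr x)).
Qed.
Definition autQI_action : alg_action (bound_alg I) (subg_of (autQI I)) :=
  AlgAction autQI_act_zmod_morphism autQI_act_monoid_morphism autQI_act_scal
    autQI_act1 autQI_actM.
End Quotient.
End QuiverAutAction.

Section Restricted.
Variables (k : pzRingType) (A : kalgType k) (gT : finGroupType).
Variables (act : alg_action A gT).

Definition restrict (G : {group gT}) (Y : lmodType (skew_alg act G)) : lmodType A :=
  res (sk_base act G) Y.

(* \bigoplus_(g in T) ^gX *)
Definition twist_sum (T : {set gT}) (X : lmodType A) : lmodType A :=
  dsum (fun g : {g | g \in T} => twist act (val g) X).
End Restricted.

(* Main.v *)
(* Call f : M -> N g-semilinear when f (l x) = g(l) f(x). Since k is algebraically closed and X is indecomposable,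
   every endomorphism of X is a scalar (its residue) plus a non-invertible one, the
   residue is multiplicative, and the non-invertible maps are closed under sums,
   also among g-semilinear self-maps of X; for g outside H = H_X no g-semilinear
   self-map of X is invertible.
   If Y restricts to the sum of the gX, let iota, pi embed X in Y and project Y on X.
   The residues chi(h) of pi h iota h^-1 form a character of H: the error terms
   factor through the summands gX with g outside H. The average j of the maps
   chi(h)^-1 h iota h^-1 is H-equivariant from chi (x) X to Y, and pi j has residue
   1, so j induces a map from the induced module to Y; it is injective by Gaussian
   elimination on the matrix of its semilinear components, hence bijective because
   both sides restrict to the same finite dimensional module. An isomorphism between
   two of the induced modules has an invertible X-component, and comparing residues
   shows that the characters agree. Finally each character of H occurs exactly once
   among the rho_i. *)

From HB Require Import structures.
Require Import Defs.
From mathcomp Require Import all_boot all_order all_algebra all_fingroup all_solvable.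
From mathcomp.classical Require Import boolp.
Set Implicit Arguments.
Unset Strict Implicit.
Unset Printing Implicit Defensive.
Import GRing.Theory.
Local Open Scope ring_scope.

(** * Polynomials in a k-linear endomorphism *)

Section PolynomialCalculus.
Variables (k : closedFieldType) (A : kalgType k).

(** The modules carry only an action of [A], so [k] acts through [scal]. Linear and semilinear maps
    alike are of this kind, and finite dimensionality is exploited at this level. *)
Definition k_linear (M N : lmodType A) (f : M -> N) :=
  zmod_morphism f /\
  forall (c : k) x, f ((scal c : A) *: x) = (scal c : A) *: f x.

Section KLinear.
Variables (M N : lmodType A) (f : M -> N).
Hypothesis f_lin : k_linear f.
Let F : {additive M -> N} :=
  HB.pack f (GRing.isZmodMorphism.Build M N f (proj1 f_lin)).
Lemma klin0 : f 0 = 0. Proof. exact: (raddf0 F). Qed.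
Lemma klinB x y : f (x - y) = f x - f y. Proof. exact: (raddfB F). Qed.
Lemma klinN x : f (- x) = - f x. Proof. exact: (raddfN F). Qed.
Lemma klinD x y : f (x + y) = f x + f y. Proof. exact: (raddfD F). Qed.
Lemma klin_sum (I : Type) (r : seq I) (P : pred I) (E : I -> M) :
  f (\sum_(i <- r | P i) E i) = \sum_(i <- r | P i) f (E i).
Proof. exact: (raddf_sum F). Qed.
Lemma klinZ (c : k) x : f ((scal c : A) *: x) = (scal c : A) *: f x.
Proof. exact: (proj2 f_lin). Qed.
Lemma klin_inj : (forall x, f x = 0 -> x = 0) -> injective f.
Proof.
by move=> f0 x y /eqP; rewrite -subr_eq0 -klinB => /eqP/f0/eqP;
   rewrite subr_eq0 => /eqP.
Qed.
End KLinear.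

Section Eval.
Variables (M : lmodType A) (f : M -> M).
Hypothesis f_lin : k_linear f.

Definition peval (p : {poly k}) (x : M) : M :=
  \sum_(i < size p) (scal p`_i : A) *: iter i f x.

Lemma peval_wide n (p : {poly k}) x : (size p <= n)%N ->
  peval p x = \sum_(i < n) (scal p`_i : A) *: iter i f x.
Proof.
move=> le_n; rewrite /peval -!(big_mkord xpredT (fun i => (scal p`_i : A) *: iter i f x)).
rewrite (big_cat_nat _ le_n) //= [X in _ + X]big_nat_cond [X in _ + X]big1 ?addr0 //.
by move=> i /andP[/andP[le_i _] _]; rewrite nth_default // raddf0 scale0r.
Qed.

Lemma pevalD (p q : {poly k}) x : peval (p + q) x = peval p x + peval q x.
Proof.
pose n := maxn (size p) (size q).
rewrite (@peval_wide n (p + q)) ?size_polyD // (@peval_wide n p) ?leq_maxl //.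
rewrite (@peval_wide n q) ?leq_maxr // -big_split; apply: eq_bigr => i _.
by rewrite coefD raddfD scalerDl.
Qed.

Lemma peval_Cmul c (p : {poly k}) x : peval (c%:P * p) x = (scal c : A) *: peval p x.
Proof.
rewrite (@peval_wide (size p)) ?mul_polyC ?size_scale_leq // scaler_sumr.
by apply: eq_bigr => i _; rewrite coefZ rmorphM scalerA.
Qed.

Lemma pevalC c x : peval c%:P x = (scal c : A) *: x.
Proof.
by rewrite (@peval_wide 1) ?size_polyC ?leq_b1 // big_ord1 coefC.
Qed.

Lemma peval1 x : peval 1 x = x.
Proof. by rewrite pevalC rmorph1 scale1r. Qed.

Lemma pevalMX (p : {poly k}) x : peval (p * 'X) x = peval p (f x).
Proof.
rewrite (@peval_wide (size p).+1) ?size_polyMX_leq //.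
  rewrite big_ord_recl coefMX raddf0 scale0r add0r.
  by apply: eq_bigr => i _; rewrite coefMX -iterSr.
by have [->|/size_mulX->] := eqVneq p 0; rewrite ?mul0r ?size_poly0.
Qed.

Lemma peval_linear p : k_linear (peval p).
Proof.
have itP i : k_linear (iter i f).
  elim: i => [|i [IHB IHZ]]; [by split | split=> [x y|c x]].
    by rewrite /= IHB (klinB f_lin).
  by rewrite /= IHZ (klinZ f_lin).
split=> [x y|c x]; rewrite /peval.
  by rewrite -sumrB; apply: eq_bigr => i _; rewrite (klinB (itP i)) scalerBr.
rewrite scaler_sumr; apply: eq_bigr => i _.
by rewrite (klinZ (itP i)) !scalerA scalC.
Qed.

Lemma peval_comm (g : M -> M) p x : k_linear g ->
  (forall y, g (f y) = f (g y)) -> peval p (g x) = g (peval p x).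
Proof.
move=> g_lin gf; rewrite /peval (klin_sum g_lin); apply: eq_bigr => i _.
rewrite (klinZ g_lin); congr (_ *: _).
by elim: (i : nat) => //= j ->; rewrite gf.
Qed.

Lemma pevalM (p q : {poly k}) x : peval (p * q) x = peval p (peval q x).
Proof.
elim/poly_ind: p x => [|p c IHp] x.
  by rewrite mul0r -[0]/(0%:P) !pevalC raddf0 !scale0r.
rewrite mulrDl !pevalD peval_Cmul pevalC; congr (_ + _).
rewrite -mulrA ['X * _]mulrC mulrA !pevalMX IHp.
by rewrite (peval_comm (g := f)).
Qed.

Lemma pevalX x : peval 'X x = f x.
Proof. by rewrite -['X]mul1r pevalMX peval1. Qed.

Lemma peval_Xn n x : peval 'X^n x = iter n f x.
Proof.
elim: n x => [|n IHn] x; first by rewrite expr0 peval1.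
by rewrite exprSr pevalMX IHn -iterSr.
Qed.

Lemma peval_XsubC a x : peval ('X - a%:P) x = f x - (scal a : A) *: x.
Proof. by rewrite -polyCN pevalD pevalX pevalC raddfN scaleNr. Qed.

(** Linear factors of [p] are split off one at a time. At the first factor ['X - a%:P] whose
    cofactor [q] does not kill [v], the vector $q(f)v$ is an eigenvector of eigenvalue [a]. *)
Lemma peval_eigenvector (p : {poly k}) v : p != 0 -> v <> 0 -> peval p v = 0 ->
  exists q c, peval q v <> 0 /\ f (peval q v) = (scal c : A) *: peval q v.
Proof.
move=> + v0; have [n] := ubnP (size p); elim: n p => // n IHn p lt_n p0 pv.
have [sz1|sz1] := eqVneq (size p) 1%N.
  have /size_poly1P[c c0 pc] := introT eqP sz1; case: v0.
  rewrite -[v]scale1r -(rmorph1 (@scal k A)) -(mulVf c0) rmorphM -scalerA.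
  by rewrite -(pevalC c v) -pc pv scaler0.
have /closed_rootP[a /factor_theorem[q pq]] := sz1.
have q0 : q != 0 by apply: contraNneq p0 => q0; rewrite pq q0 mul0r.
have [qv|qv] := EM (peval q v = 0).
  apply: (IHn q _ q0 qv); move: lt_n.
  by rewrite pq size_Mmonic ?monicXsubC // size_XsubC addn2.
exists q, a; split=> //; apply/eqP; rewrite -subr_eq0 -peval_XsubC -pevalM.
by rewrite mulrC -pq pv.
Qed.

End Eval.

(** * Endomorphisms of a finite dimensional module *)

Section FiniteDim.
Variables (M : lmodType A).
Hypothesis M_fin : fin_dim M.

(** Cayley-Hamilton is applied to a matrix [C] that lifts [f] along the surjection [B] from row
    vectors onto [M]; in this way a spanning family takes the place of a basis. *)
Lemma fin_dim_annihilator (f : M -> M) : k_linear f ->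
  exists2 p : {poly k}, p != 0 & forall x, peval f p x = 0.
Proof.
move=> f_lin; have [n [b bP]] := M_fin.
(* [horner_mx] lives on matrices of positive size. With an empty spanning family [M] is zero and the
   polynomial 1 kills it. *)
case: n b bP => [|n] b bP.
  exists 1 => [|x]; first exact: oner_neq0.
  by have [c ->] := bP (peval f 1 x); rewrite big_ord0.
have /choice[c cP] : forall j, exists c : 'I_n.+1 -> k,
  f (b j) = \sum_(i < n.+1) (scal (c i) : A) *: b i by move=> j; apply: bP.
pose B (v : 'rV[k]_n.+1) := \sum_(i < n.+1) (scal (v 0 i) : A) *: b i.
pose C : 'M[k]_n.+1 := \matrix_(j, i) c j i.
have BD u v : B (u + v) = B u + B v.
  by rewrite -big_split; apply: eq_bigr => i _; rewrite mxE raddfD scalerDl.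
have BZ a v : B (a *: v) = (scal a : A) *: B v.
  by rewrite scaler_sumr; apply: eq_bigr => i _; rewrite mxE rmorphM scalerA.
have fB v : f (B v) = B (v *m C).
  rewrite (klin_sum f_lin); under eq_bigr => j _ do
    rewrite (klinZ f_lin) cP scaler_sumr.
  rewrite exchange_big; apply: eq_bigr => i _; rewrite mxE rmorph_sum scaler_suml.
  by apply: eq_bigr => j _; rewrite /= mxE rmorphM scalerA.
have pB p v : peval f p (B v) = B (v *m horner_mx C p).
  elim/poly_ind: p v => [|p a IHp] v.
    rewrite -[0]/(0%:P) pevalC raddf0 scale0r rmorph0 mulmx0.
    by rewrite -(scale0r (0 : 'rV[k]_n.+1)) BZ raddf0 scale0r.
  rewrite pevalD pevalMX pevalC fB IHp -BZ -BD.
  rewrite rmorphD rmorphM /= horner_mx_C horner_mx_X mulmxDr mul_mx_scalar.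
  by rewrite -mulmxE -(mulmxA v) (comm_mx_horner p (comm_mx_refl C)).
exists (char_poly C); first exact/monic_neq0/char_poly_monic.
move=> x; have [d ->] := bP x.
have -> : \sum_(i < n.+1) (scal (d i) : A) *: b i = B (\row_i d i).
  by apply: eq_bigr => i _; rewrite mxE.
rewrite pB Cayley_Hamilton mulmx0.
by rewrite -(scale0r (0 : 'rV[k]_n.+1)) BZ raddf0 scale0r.
Qed.

(* f satisfies x^m q(x) = 0 with q(0) <> 0; when f is injective or surjective,
   the factor x^m can be cancelled, and q gives the inverse of f. *)
Lemma fin_dim_bij (f : M -> M) : k_linear f ->
  injective f \/ (forall y, exists x, f x = y) -> bijective f.
Proof.
move=> f_lin f_is; have [p p0 pf] := fin_dim_annihilator f_lin.
have [m [q q0 pq]] := multiplicity_XsubC p 0.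
rewrite p0 /= in q0; rewrite subr0 in pq.
have qf x : peval f q x = 0.
  case: f_is => [f_inj|f_surj].
    have: iter m f (peval f q x) = 0 by rewrite -peval_Xn -pevalM // mulrC -pq.
    elim: m {pq} => //= m IHm fy; apply/IHm/f_inj.
    by rewrite fy (klin0 f_lin).
  have [y <-] : exists y, iter m f y = x.
    elim: m x {pq} => [|m IHm] x; first by exists x.
    by have [y <-] := f_surj x; have [z <-] := IHm y; exists z.
  by rewrite -peval_Xn -pevalM // -pq.
have q00 : q.[0] != 0 by [].
(* Dividing [q] by ['X] turns $q(f) = 0$ into $s(f) f = -q(0)$, so $-q(0)^{-1} s(f)$ inverts [f]. *)
have [s sP] : exists s, q = s * 'X + q.[0]%:P.
  have /factor_theorem[s] : root (q - q.[0]%:P) 0.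
    by rewrite /root !hornerE subrr.
  by rewrite subr0 => qs; exists s; rewrite -qs subrK.
have fs x : peval f s (f x) = - (scal q.[0] : A) *: x.
  apply/eqP; rewrite scaleNr -subr_eq0 opprK -pevalMX -(pevalC f) -pevalD -sP.
  by rewrite qf.
have inv x : (scal (- q.[0]^-1) : A) *: (- (scal q.[0] : A) *: x) = x.
  by rewrite raddfN scalerA mulrNN -rmorphM mulVf // rmorph1 scale1r.
exists (fun x => (scal (- q.[0]^-1) : A) *: peval f s x) => x /=.
  by rewrite fs inv.
rewrite (klinZ f_lin) -(peval_comm (f := f) s x f_lin) //.
by rewrite fs inv.
Qed.

End FiniteDim.
End PolynomialCalculus.

(** * Semilinear maps *)

Section Semilinear.
Variables (k : closedFieldType) (A : kalgType k) (gT : finGroupType).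
Variable act : alg_action A gT.

(** Equivalently, an [A]-linear map from the twist of [M] by [g] to [N]. Keeping [M] untwisted makes
    the degrees [g] multiply under composition, and degree 1 is linearity. *)
Definition semilinear (g : gT) (M N : lmodType A) (f : M -> N) :=
  zmod_morphism f /\ forall a x, f (a *: x) = act g a *: f x.

Section Basics.
Variables (M N P : lmodType A).

Lemma semilinear_klin g (f : M -> N) : semilinear g f -> k_linear f.
Proof. by case=> fB fZ; split=> // c x; rewrite fZ aact_scal. Qed.

Lemma semilinear_id : semilinear 1 (@idfun M).
Proof. by split=> // a x; rewrite aact1. Qed.

Lemma linear_semilinear (f : {linear M -> N}) : semilinear 1 f.
Proof. by split=> [x y|a x]; rewrite ?raddfB // aact1 linearZ. Qed.

Lemma semilinear_linear (f : M -> N) : semilinear 1 f -> linear f.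
Proof.
move=> fS a x y; rewrite (klinD (semilinear_klin fS)); case: fS => _ ->.
by rewrite aact1.
Qed.

Lemma semilinear_comp g h (f : N -> P) (f' : M -> N) :
  semilinear g f -> semilinear h f' -> semilinear (g * h)%g (f \o f').
Proof.
by move=> [fB fZ] [gB gZ]; split=> [x y|a x] /=; rewrite ?gB ?fB // gZ fZ aactM.
Qed.

Lemma semilinear1_comp (f : N -> P) (f' : M -> N) :
  semilinear 1 f -> semilinear 1 f' -> semilinear 1 (f \o f').
Proof. by move=> fS /(semilinear_comp fS); rewrite mulg1. Qed.

Lemma semilinear_inv g (f : M -> N) f' : semilinear g f ->
  cancel f f' -> cancel f' f -> semilinear g^-1 f'.
Proof.
move=> [fB fZ] fK f'K; split=> [x y|a x].
  by apply: (can_inj fK); rewrite fB !f'K.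
by apply: (can_inj fK); rewrite fZ !f'K -aactM mulgV aact1.
Qed.

Lemma semilinearD g (f f' : M -> N) :
  semilinear g f -> semilinear g f' -> semilinear g (fun x => f x + f' x).
Proof.
move=> [fB fZ] [gB gZ]; split=> [x y|a x]; last by rewrite fZ gZ scalerDr.
by rewrite fB gB opprD addrACA.
Qed.

Lemma semilinearZ g (c : k) (f : M -> N) :
  semilinear g f -> semilinear g (fun x => (scal c : A) *: f x).
Proof.
move=> [fB fZ]; split=> [x y|a x]; first by rewrite fB scalerBr.
by rewrite fZ !scalerA scalC.
Qed.

Lemma semilinearN g (f : M -> N) :
  semilinear g f -> semilinear g (fun x => - f x).
Proof.
move=> [fB fZ]; split=> [x y|a x]; first by rewrite fB opprD opprK.
by rewrite fZ scalerN.
Qed.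

Lemma semilinearB g (f f' : M -> N) :
  semilinear g f -> semilinear g f' -> semilinear g (fun x => f x - f' x).
Proof. by move=> fS f'S; apply: (semilinearD fS); apply: semilinearN. Qed.

Lemma semilinear_sum (I : Type) (r : seq I) (Q : pred I) g (f : I -> M -> N) :
  (forall i, Q i -> semilinear g (f i)) ->
  semilinear g (fun x => \sum_(i <- r | Q i) f i x).
Proof.
move=> fS; split=> [x y|a x].
  by rewrite -sumrB; apply: eq_bigr => i Qi; case: (fS i Qi) => ->.
by rewrite scaler_sumr; apply: eq_bigr => i Qi; case: (fS i Qi) => _ ->.
Qed.

End Basics.

Lemma peval_semilinear (M : lmodType A) (f : M -> M) p :
  semilinear 1 f -> semilinear 1 (peval f p).
Proof.
move=> fS; have it i : semilinear 1 (iter i f).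
  elim: i => [|i IHi]; first exact: semilinear_id.
  by rewrite -[1%g]mulg1; apply: semilinear_comp.
by apply: semilinear_sum => i _; apply: semilinearZ.
Qed.

End Semilinear.

(** * Idempotent endomorphisms and direct summands *)

Section FixedSubmodule.
Variables (R : pzRingType) (M : lmodType R) (e : {linear M -> M}).
(** For an idempotent [e] the fixed points are its image. Described by an equation, they form a
    boolean predicate and hence a subtype. *)
Definition fixed_pred (x : M) : bool := e x == x.
Fact fixed_pred_closed : submod_closed fixed_pred.
Proof.
split=> [|a x y /eqP ex /eqP ey]; first by rewrite unfold_in /fixed_pred raddf0.
by rewrite unfold_in /fixed_pred linearP ex ey.
Qed.
HB.instance Definition _ := GRing.isSubmodClosed.Build R M fixed_pred
  fixed_pred_closed.
Definition fixed_mod : Type := {x : M | fixed_pred x}.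
HB.instance Definition _ := Choice.on fixed_mod.
HB.instance Definition _ := SubChoice.on fixed_mod.
HB.instance Definition _ := [SubChoice_isSubLmodule of fixed_mod by <:].
End FixedSubmodule.

(** [M] is the direct sum of the images of [e] and of $1 - e$, and one of the two must vanish. *)
Lemma indecomposable_idempotent (R : pzRingType) (M : lmodType R)
    (e : {linear M -> M}) : indecomposable M -> (forall x, e (e x) = e x) ->
  (forall x, e x = 0) \/ (forall x, e x = x).
Proof.
move=> [_ M_indec] ee.
pose e'f (x : M) := x - e x.
have e'_lin : linear e'f.
  move=> a x y; rewrite /e'f linearP scalerBr opprD !addrA; congr (_ - _).
  by rewrite addrAC.
pose e' : {linear M -> M} := HB.pack e'f (GRing.isLinear.Build R M M *:%R e'f e'_lin).
have fe x : fixed_pred e (e x) by rewrite /fixed_pred ee.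
have fe' x : fixed_pred e' (e' x).
  by rewrite /fixed_pred /= /e'f raddfB /= ee subrr subr0.
have [] := M_indec (fixed_mod e) (fixed_mod e').
- pose f (x : M) : (fixed_mod e * fixed_mod e')%type :=
    (exist _ (e x) (fe x), exist _ (e' x) (fe' x)).
  apply: (@iso_by _ _ _ f).
    by move=> a x y; congr pair; apply: val_inj; [exact: (linearP e) | exact: e'_lin].
  exists (fun xy => val xy.1 + val xy.2) => [x|[[x ex] [y ey]]] /=.
    by rewrite /e'f addrC subrK.
  have ex0 := eqP ex; have ey0 : e y = 0.
    by have /eqP := eqP ey; rewrite /= /e'f -subr_eq0 addrAC subrr sub0r oppr_eq0 => /eqP.
  congr pair; apply: val_inj; rewrite /= ?/e'f raddfD /= ex0 ey0 addr0 //.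
  by rewrite addrAC subrr add0r.
- by left=> x; have /(congr1 val) := a (exist _ (e x) (fe x)).
by right=> x; have /(congr1 val)/= /eqP := b (exist _ (e' x) (fe' x));
   rewrite subr_eq0 => /eqP.
Qed.

(** * The local endomorphism ring of an indecomposable module *)

Lemma bijective_inverse (T U : Type) (f : T -> U) :
  bijective f -> exists2 f', cancel f f' & cancel f' f.
Proof. by case=> f'; exists f'. Qed.

Section Local.
Variables (k : closedFieldType) (A : kalgType k) (gT : finGroupType).
Variable act : alg_action A gT.
Variable X : lmodType A.
Hypotheses (X_fin : fin_dim X) (X_indec : indecomposable X).
Local Notation SL := (semilinear act).
Implicit Types (f u v : X -> X) (g h : gT) (c d : k).

Lemma peval_eigen (M : lmodType A) (f : M -> M) (p : {poly k}) c x :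
  k_linear f -> f x = (scal c : A) *: x -> peval f p x = (scal p.[c] : A) *: x.
Proof.
move=> f_lin fx; elim/poly_ind: p => [|p d IHp].
  by rewrite horner0 -[0 in LHS]/(0%:P) pevalC raddf0 !scale0r.
rewrite pevalD pevalMX pevalC fx (klinZ (peval_linear f_lin p)) IHp.
by rewrite scalerA -rmorphM -scalerDl -rmorphD !hornerE mulrC.
Qed.

(* Fitting: f is killed by x^m q with q(0) <> 0, and the Bezout idempotent of the
   coprime factors x^m and q is 0 or 1. *)
Lemma indecomposable_bij_nilp f : SL 1 f ->
  bijective f \/ exists m, forall x, iter m f x = 0.
Proof.
move=> fS; have f_lin := semilinear_klin fS.
have [p p0 pf] := fin_dim_annihilator X_fin f_lin.
have [m [q q0 pq]] := multiplicity_XsubC p 0.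
rewrite p0 /= in q0; rewrite subr0 in pq.
have /Bezout_eq1_coprimepP[[u1 u2] /= u12] : coprimep 'X^m q.
  rewrite coprimep_expl // coprimep_sym -['X]subr0 -polyC0.
  by rewrite coprimep_XsubC.
pose e := peval f (u1 * 'X^m).
have eS : SL 1 e by apply: peval_semilinear.
have u12x x : x = e x + peval f (u2 * q) x.
  by rewrite -pevalD u12 peval1.
have p_dvd r x : peval f (r * p) x = 0.
  by rewrite pevalM // pf (klin0 (peval_linear f_lin r)).
(* By [u12x], $1 - e$ is $(u_2 q)(f)$, so $e(1 - e)$ is a multiple of $p(f) = 0$. *)
have ee x : e (e x) = e x.
  rewrite [in RHS](u12x x) (klinD (semilinear_klin eS)).
  by rewrite /e -(pevalM _ _ (u2 * q)) // mulrACA [_ * q]mulrC -pq p_dvd addr0.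
pose eL : {linear X -> X} :=
  HB.pack e (GRing.isLinear.Build A X X *:%R e (semilinear_linear eS)).
have [e0|e1] := indecomposable_idempotent (e := eL) X_indec ee.
  right; exists m => x; rewrite -peval_Xn [x]u12x [e x]e0 add0r. rewrite -pevalM //.
  by rewrite mulrCA [_ * q]mulrC -pq p_dvd.
left; apply: (fin_dim_bij X_fin f_lin); left; apply: (klin_inj f_lin) => x fx.
have := e1 x; rewrite [eL x]/(e x) => ex.
(* Here $q(f) = q(f) e$ is a multiple of $p(f)$, while on the kernel of [f] it is multiplication by
   $q(0) \neq 0$. *)
have: peval f q x = 0 by rewrite -ex -pevalM // mulrCA -pq p_dvd.
rewrite (peval_eigen q (c := 0) f_lin); last by rewrite raddf0 scale0r.
move=> /(congr1 (fun y => (scal q.[0]^-1 : A) *: y)).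
by rewrite scaler0 scalerA -rmorphM mulVf ?rmorph1 ?scale1r.
Qed.

Lemma zero_nonbij : ~ bijective (fun _ : X => 0 : X).
Proof.
by case=> f' fK _; case: X_indec => nz _; apply: nz => x; rewrite -(fK x) (fK 0).
Qed.

(** With [u] the inverse of the sum, $uf + uf' = 1$ and $uf$ has degree 1, so it is bijective or
    nilpotent. In the nilpotent case $uf$ is the identity on the kernel of $f'$, which is therefore
    zero. *)
Lemma bijD g f f' : SL g f -> SL g f' -> bijective (fun x => f x + f' x) ->
  bijective f \/ bijective f'.
Proof.
move=> fS f'S /bijective_inverse[u uK Ku].
have uS := semilinear_inv (semilinearD fS f'S) uK Ku.
have ufS : SL 1 (u \o f) by rewrite -(mulVg g); apply: semilinear_comp.
have [ufb|[m nilp]] := indecomposable_bij_nilp ufS.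
  by left; apply: (eq_bij (bij_comp (Bijective uK Ku) ufb)) => x /=; rewrite Ku.
right; apply: (fin_dim_bij X_fin (semilinear_klin f'S)); left.
apply: (klin_inj (semilinear_klin f'S)) => x f'x.
have ux : u (f x) = x by rewrite -[RHS]uK f'x addr0.
by rewrite -(nilp x); elim: m {nilp} => //= m <-; rewrite ux.
Qed.

Lemma bijB g f f' : SL g f -> SL g f' -> bijective (fun x => f x - f' x) ->
  bijective f \/ bijective f'.
Proof.
move=> fS f'S /(bijD fS (semilinearN f'S))[|b]; [by left | right].
have oppb : bijective (@GRing.opp X) by exists -%R; apply: opprK.
by apply: (eq_bij (bij_comp oppb b)) => x /=; rewrite opprK.
Qed.

Lemma bij_sum (I : Type) (r : seq I) (P : pred I) g (F : I -> X -> X) :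
  (forall i, P i -> SL g (F i)) -> bijective (fun x => \sum_(i <- r | P i) F i x) ->
  exists2 i, P i & bijective (F i).
Proof.
move=> FS; elim: r => [|i r IHr].
  by move/(@eq_bij _ _ _) => b; case: zero_nonbij; apply: b => x; rewrite big_nil.
have [Pi|nPi] := boolP (P i); last first.
  move=> b; apply: IHr; apply: (eq_bij b) => x; rewrite big_cons (negPf nPi) //.
move=> b; have [||||/IHr//] := @bijD g (F i) (fun x => \sum_(i <- r | P i) F i x).
- exact: FS.
- exact: semilinear_sum.
- by apply: (eq_bij b) => x; rewrite big_cons Pi.
by exists i.
Qed.

(** The composite makes [f] surjective and [f'] injective, and either property implies bijectivity
    on a finite dimensional [X]. *)
Lemma bij_compE g h f f' : SL g f -> SL h f' -> bijective (f \o f') ->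
  bijective f /\ bijective f'.
Proof.
move=> fS f'S /bijective_inverse[u uK Ku]; split.
  by apply: (fin_dim_bij X_fin (semilinear_klin fS)); right=> y;
     exists (f' (u y)); rewrite -[RHS]Ku.
by apply: (fin_dim_bij X_fin (semilinear_klin f'S)); left=> x y xy;
   rewrite -(uK x) -(uK y) /= xy.
Qed.

Lemma scal_bij (M : lmodType A) c : c != 0 ->
  bijective (fun x : M => (scal c : A) *: x).
Proof.
by move=> c0; exists (fun x : M => (scal c^-1 : A) *: x) => x;
   rewrite scalerA -rmorphM ?mulVf ?mulfV // rmorph1 scale1r.
Qed.

Lemma scal_semilinear (M : lmodType A) c :
  semilinear act 1 (fun x : M => (scal c : A) *: x).
Proof. exact: semilinearZ (semilinear_id act M). Qed.

(* The residue of u in End(X) / rad End(X) = k is c. *)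
Definition residue u c := ~ bijective (fun x => u x - (scal c : A) *: x).

Let subS u c : SL 1 u -> SL 1 (fun x => u x - (scal c : A) *: x).
Proof. by move=> uS; apply: semilinearB => //; apply: scal_semilinear. Qed.

(** Any eigenvalue [c] of [u] serves, since $u - c$ has a kernel. *)
Lemma residue_exists u : SL 1 u -> exists c, residue u c.
Proof.
move=> uS; have u_lin := semilinear_klin uS.
have [p p0 pu] := fin_dim_annihilator X_fin u_lin.
have [v v0] : exists v : X, v <> 0.
  apply: contrapT => nex; case: X_indec => + _; apply=> x.
  by apply: contrapT => x0; apply: nex; exists x.
have [q [c [w0 uw]]] := peval_eigenvector u_lin p0 v0 (pu v).
exists c; case=> u' uK _; apply: w0; rewrite -[LHS]uK -[RHS]uK uw subrr.
by rewrite (klin0 u_lin) scaler0 subrr.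
Qed.

(** For $c \neq d$ the difference of $u - d$ and $u - c$ is a nonzero scalar, hence invertible, so
    one of the two would be invertible as well. *)
Lemma residue_unique u c d : SL 1 u -> residue u c -> residue u d -> c = d.
Proof.
move=> uS uc ud; apply: contrapT => /eqP; rewrite -subr_eq0 => cd0.
have b : bijective (fun x : X => (u x - (scal d : A) *: x) - (u x - (scal c : A) *: x)).
  apply: (eq_bij (scal_bij X cd0)) => x.
  by rewrite opprB [RHS]addrC addrA subrK raddfB scalerBl.
by case: (bijB (subS _ uS) (subS _ uS) b).
Qed.

Lemma residue0 u : residue u 0 <-> ~ bijective u.
Proof.
by split=> nb b; apply: nb; apply: (eq_bij b) => x; rewrite raddf0 scale0r subr0.
Qed.

Lemma residue_bij u c : SL 1 u -> residue u c -> bijective u <-> c <> 0.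
Proof.
move=> uS uc; split=> [b c0|c0].
  by rewrite c0 in uc; apply: ((residue0 u).1 uc).
apply: contrapT => u0; apply: c0.
exact: residue_unique uS uc ((residue0 u).2 u0).
Qed.

Lemma residue_scal c : residue (fun x => (scal c : A) *: x) c.
Proof. by move=> /eq_bij b; apply: zero_nonbij; apply: b => x; rewrite subrr. Qed.

Lemma residue_id : residue id 1.
Proof.
by move=> /eq_bij b; apply: zero_nonbij; apply: b => x;
   rewrite rmorph1 scale1r subrr.
Qed.

Lemma eq_residue u v c : u =1 v -> residue u c -> residue v c.
Proof. by move=> uv uc b; apply: uc; apply: (eq_bij b) => x; rewrite uv. Qed.

Lemma residueD u v c d : SL 1 u -> SL 1 v -> residue u c -> residue v d ->
  residue (fun x => u x + v x) (c + d).
Proof.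
move=> uS vS uc vd b.
have [] // := @bijD 1 (fun x => u x - (scal c : A) *: x)
  (fun x => v x - (scal d : A) *: x) (subS _ uS) (subS _ vS).
by apply: (eq_bij b) => x; rewrite raddfD scalerDl opprD addrACA.
Qed.

Lemma residue_sum (I : Type) (r : seq I) (P : pred I) (u : I -> X -> X) (c : I -> k) :
  (forall i, P i -> SL 1 (u i)) -> (forall i, P i -> residue (u i) (c i)) ->
  residue (fun x => \sum_(i <- r | P i) u i x) (\sum_(i <- r | P i) c i).
Proof.
move=> uS uc; elim: r => [|i r IHr].
  rewrite big_nil residue0 => /eq_bij b.
  by apply: zero_nonbij; apply: b => x; rewrite big_nil.
rewrite big_cons; case: ifP => Pi; last first.
  by apply: eq_residue IHr => x; rewrite big_cons Pi.
apply: eq_residue (residueD (uS i Pi) (semilinear_sum _ uS) (uc i Pi) IHr) => x.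
by rewrite big_cons Pi.
Qed.

(** $uv - cd = (u - c)v + c(v - d)$, and neither summand is invertible. *)
Lemma residue_comp u v c d : SL 1 u -> SL 1 v -> residue u c -> residue v d ->
  residue (u \o v) (c * d).
Proof.
move=> uS vS uc vd b.
have S1 : SL 1 (fun x => u (v x) - (scal c : A) *: v x).
  by rewrite -[1%g]mulg1; apply: (semilinear_comp (subS c uS) vS).
have S2 : SL 1 (fun x => (scal c : A) *: (v x - (scal d : A) *: x)).
  by apply: semilinearZ; apply: subS.
have [||] := bijD S1 S2.
- apply: (eq_bij b) => x /=.
  by rewrite scalerBr addrA subrK scalerA rmorphM.
- by case/(bij_compE (f := fun x => u x - (scal c : A) *: x) (subS c uS) vS).
by case/(bij_compE (f := fun x => (scal c : A) *: x) (scal_semilinear X c) (subS d vS)).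
Qed.

Lemma residueZ u c d : SL 1 u -> residue u c ->
  residue (fun x => (scal d : A) *: u x) (d * c).
Proof.
by move=> uS uc; apply: (residue_comp (scal_semilinear X d) uS (@residue_scal d) uc).
Qed.

(** Semilinear maps commute with the scalars of [k], so $f(u - c)f^{-1} = fuf^{-1} - c$. *)
Lemma residue_conj g u c (f f' : X -> X) : SL g f -> cancel f f' -> cancel f' f ->
  residue u c -> residue (f \o u \o f') c.
Proof.
move=> fS fK f'K uc b; apply: uc.
have fb : bijective f by exists f'.
have f'b : bijective f' by exists f.
apply: (eq_bij (bij_comp f'b (bij_comp b fb))) => x /=.
have f_lin := semilinear_klin fS.
by rewrite !fK -(klinZ f_lin) -(klinB f_lin) fK.
Qed.

(* Gaussian elimination: invertible diagonal entries stay invertible because the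
   corrections are products of non-invertible entries. *)
Lemma local_matrix_inj (I : eqType) (lab : I -> gT) (T : seq I)
    (K : I -> I -> X -> X) (x : I -> X) :
  uniq T ->
  {in T &, forall s t, SL ((lab s)^-1 * lab t) (K s t)} ->
  {in T, forall t, bijective (K t t)} ->
  {in T &, forall s t, s != t -> ~ bijective (K s t)} ->
  {in T, forall s, \sum_(t <- T) K s t (x t) = 0} ->
  {in T, forall t, x t = 0}.
Proof.
elim: T K => // s0 T IHT K /= /andP[s0T uT] KS Kd Ko Kx.
have s0in : s0 \in s0 :: T by rewrite mem_head.
have Tin t : t \in T -> t \in s0 :: T by rewrite inE orbC => ->.
have [L LK KL] := bijective_inverse (Kd s0 s0in).
have LS : SL 1 L.
  have := semilinear_inv (KS s0 s0 s0in s0in) LK KL.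
  by rewrite mulVg invg1.
(* The Schur complement of the pivot at [s0], whose inverse is [L]; the degrees $s^{-1}t$ of the
   entries are preserved. *)
pose K' s t y := K s t y - K s s0 (L (K s0 t y)).
have cS s t : s \in T -> t \in T -> SL ((lab s)^-1 * lab t) (K s s0 \o (L \o K s0 t)).
  move=> sT tT.
  have -> : ((lab s)^-1 * lab t = (lab s)^-1 * lab s0 * ((lab s0)^-1 * lab t))%g.
    by rewrite -mulgA (mulKVg (lab s0)).
  apply: semilinear_comp; first by apply: KS => //; apply: Tin.
  by rewrite -[((lab s0)^-1 * lab t)%g]mul1g; apply: semilinear_comp => //;
     apply: KS => //; apply: Tin.
have cN s t : s \in T -> t \in T -> ~ bijective (K s s0 \o (L \o K s0 t)).
  move=> sT tT.
  have LKS : SL ((lab s0)^-1 * lab t) (L \o K s0 t).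
    by rewrite -[((lab s0)^-1 * lab t)%g]mul1g; apply: semilinear_comp => //;
     apply: KS => //; apply: Tin.
  case/(bij_compE (KS s s0 (Tin s sT) s0in) LKS) => + _.
  by apply: (Ko _ _ (Tin s sT) s0in); apply: contraNneq s0T => <-.
have K'S s t : s \in T -> t \in T -> SL ((lab s)^-1 * lab t) (K' s t).
  by move=> sT tT; apply: semilinearB (cS s t sT tT); apply: KS; apply: Tin.
have xs0 : x s0 = - L (\sum_(t <- T) K s0 t (x t)).
  have := Kx s0 s0in; rewrite big_cons => /eqP; rewrite addr_eq0 => /eqP.
  move/(congr1 L); rewrite LK => ->.
  exact: (klinN (semilinear_klin LS)).
have xT : {in T, forall t, x t = 0}.
  apply: (IHT K') => //.
  - move=> t tT.
    have b : bijective (fun y => K' t t y + (K t s0 \o (L \o K s0 t)) y).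
      by apply: (eq_bij (Kd t (Tin t tT))) => y /=; rewrite subrK.
    by case: (bijD (K'S t t tT tT) (cS t t tT tT) b) => // b'; case: (cN t t tT tT b').
  - move=> s t sT tT st.
    case/(bijB (KS s t (Tin s sT) (Tin t tT)) (cS s t sT tT)); last exact: cN.
    by apply: Ko => //; apply: Tin.
  move=> s sT; rewrite sumrB; apply/eqP.
  have := Kx s (Tin s sT); rewrite big_cons xs0.
  have Ks_lin := semilinear_klin (KS s s0 (Tin s sT) s0in).
  rewrite (klinN Ks_lin) (klin_sum (semilinear_klin LS)) (klin_sum Ks_lin).
  by rewrite addrC => ->.
move=> t; rewrite inE => /orP[/eqP->|/xT//].
rewrite xs0 big_seq big1 ?(klin0 (semilinear_klin LS)) ?oppr0 // => t' t'T.
by rewrite xT // (klin0 (semilinear_klin (KS s0 t' s0in (Tin t' t'T)))).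
Qed.

End Local.

(** * Module isomorphisms and coset representatives *)

Lemma linear_bundle (R : pzRingType) (M N : lmodType R) (f : M -> N) :
  linear f -> exists F : {linear M -> N}, F =1 f.
Proof.
move=> f_lin.
by exists (HB.pack_for {linear M -> N} f (GRing.isLinear.Build R M N *:%R f f_lin)).
Qed.

Lemma iso_sym (R : pzRingType) (M N : lmodType R) : iso M N -> iso N M.
Proof.
case=> f [f' fK f'K]; apply: (@iso_by _ N M f'); last by exists f.
by move=> a x y; apply: (can_inj fK); rewrite linearP !f'K.
Qed.

Lemma iso_trans (R : pzRingType) (M N P : lmodType R) :
  iso M N -> iso N P -> iso M P.
Proof.
case=> f fb [g gb]; apply: (@iso_by _ M P (g \o f)); last exact: bij_comp.
by move=> a x y /=; rewrite !linearP.
Qed.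

(** The condition $t^{-1}g \in H$ says that [t] represents $gH$; it is phrased through $t^{-1}g$
    because this is the degree of the maps between summands. *)
Lemma left_transversalP (gT : finGroupType) (G H : {group gT}) (T : {set gT}) :
  is_transversal T (lcosets H G) G ->
  {subset T <= G} /\
  forall g, g \in G -> exists i : {t | t \in T},
    ((val i)^-1 * g)%g \in H /\ forall j : {t | t \in T}, ((val j)^-1 * g)%g \in H -> j = i.
Proof.
move=> /and3P[_ /subsetP sTG /forall_inP T1]; split=> // g gG.
have /cards1P[t Tt] : #|T :&: (g *: H)%g| == 1%N by apply: T1; apply/lcosetsP; exists g.
have tT : t \in T by have := set11 t; rewrite -Tt inE => /andP[].
exists (exist _ t tT); split=> /= [|j].
  by have := set11 t; rewrite -Tt inE lcoset_sym mem_lcoset => /andP[].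
rewrite -mem_lcoset lcoset_sym => jg; apply: val_inj => /=.
by apply/set1P; rewrite -Tt inE (valP j).
Qed.

(** * Modules over the skew group algebra *)

Section SkewModule.
Variables (k : closedFieldType) (A : kalgType k) (gT : finGroupType).
Variables (act : alg_action A gT) (G : {group gT}).
Local Notation S := (skew_alg act G).

Section Action.
Variable Y : lmodType S.

(** Defined on all of [gT] to avoid elements of [subg_of G]. Outside [G], [subg] returns 1, so the
    group laws are stated on [G]. *)
Definition gmul (g : gT) (y : Y) : Y := sk act (subg G g) 1 *: y.

Lemma sk_gmul g a (y : Y) :
  sk act (subg G g) a *: y = gmul g (sk_base act G a *: y).
Proof. by rewrite /gmul scalerA sk_mulE mulg1 invg1 aact1 mul1r. Qed.

Lemma gmulM : {in G &, forall g h (y : Y), gmul (g * h)%g y = gmul g (gmul h y)}.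
Proof.
move=> g h gG hG y; rewrite /gmul scalerA sk_mulE rmorph1 mulr1.
by congr (sk _ _ _ *: _); apply: val_inj; rewrite /= !subgK ?groupM.
Qed.

Lemma gmul1 (y : Y) : gmul 1 y = y.
Proof.
rewrite /gmul (_ : sk act _ 1 = 1) ?scale1r //; congr sk.
by apply: val_inj; rewrite /= subgK.
Qed.

Lemma gmulK : {in G, forall g, cancel (@gmul g) (@gmul g^-1)}.
Proof. by move=> g gG y; rewrite -gmulM ?groupV // mulVg gmul1. Qed.
Lemma gmulVK : {in G, forall g, cancel (@gmul g^-1) (@gmul g)}.
Proof. by move=> g gG y; rewrite -gmulM ?groupV // mulgV gmul1. Qed.

(** This is the relation $g a = g(a) g$ of the skew group algebra. *)
Lemma gmul_semilinear :
  {in G, forall g, semilinear act g (@gmul g : restrict Y -> restrict Y)}.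
Proof.
move=> g gG; split=> [x y|a x]; first exact: (scalerBr _ (x : Y) (y : Y)).
transitivity (sk act (subg G g) a *: (x : Y)); first exact/esym/sk_gmul.
transitivity (sk_base act G (act g a) *: gmul g (x : Y)) => //.
rewrite /gmul scalerA /sk_base sk_mulE mul1g mulr1 subgK //.
by rewrite -aactM mulVg aact1.
Qed.

(** The action of [g] is itself an isomorphism from the twist by [g]. *)
Lemma restrict_g_invariant : g_invariant act G (restrict Y).
Proof.
move=> g gG; have [gB gZ] := gmul_semilinear gG.
apply: (@iso_by _ (twist act g (restrict Y)) (restrict Y) (@gmul g)).
  move=> a x y; rewrite (klinD (semilinear_klin (conj gB gZ))).
  rewrite [X in gmul g X]/(act g^-1%g a *: (x : restrict Y)).
  by rewrite gZ -aactM mulgV aact1.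
by exists (@gmul g^-1); [apply: gmulK | apply: gmulVK].
Qed.

End Action.

Lemma linear_gmul (Y Z : lmodType S) (f : {linear Y -> Z}) g y :
  f (gmul g y) = gmul g (f y).
Proof. exact: linearZ. Qed.

Lemma linear_restrict (Y Z : lmodType S) (f : {linear Y -> Z}) :
  semilinear act 1 (f : restrict Y -> restrict Z).
Proof.
split=> [x y|a x]; first exact: raddfB.
by rewrite aact1; apply: (linearZZ f (sk_base act G a) (x : Y)).
Qed.

End SkewModule.

(** * The orbit sum of the twists of [X] *)

Section TwistSum.
Variables (k : closedFieldType) (A : kalgType k) (gT : finGroupType).
Variables (act : alg_action A gT) (T : {set gT}) (X : lmodType A).
Local Notation I := {t | t \in T}.
Local Notation M := (twist_sum act T X).

Definition ts_in (i : I) (x : X) : M :=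
  [ffun j : I => (if j == i then x else 0) : twist act (val j) X].
Definition ts_out (i : I) (m : M) : X := m i.

(** On vectors the inclusion is the identity of [X], and the identity from [X] to its twist by [t]
    has degree [t]. *)
Lemma ts_in_semilinear i : semilinear act (val i) (ts_in i).
Proof.
split=> [x y|a x]; apply/ffunP=> j; rewrite !ffunE; first by case: eqP; rewrite ?subrr.
case: eqP => [->|_]; last by rewrite scaler0.
by rewrite [RHS]/(act (val i)^-1%g (act (val i) a) *: x) -aactM mulVg aact1.
Qed.

Lemma ts_out_semilinear i : semilinear act (val i)^-1 (ts_out i).
Proof. by split=> [x y|a x]; rewrite /ts_out !ffunE. Qed.

Lemma ts_in_out m : m = \sum_i ts_in i (ts_out i m).
Proof.
apply/ffunP=> j; rewrite sum_ffunE (bigD1 j) //= big1 ?addr0 => [|i neq].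
  by rewrite ffunE eqxx.
by rewrite ffunE eq_sym (negPf neq).
Qed.

Lemma ts_out_in i x : ts_out i (ts_in i x) = x.
Proof. by rewrite /ts_out ffunE eqxx. Qed.

Lemma twist_sum_fin_dim : fin_dim X -> fin_dim M.
Proof.
case=> n [b bP].
pose b' (p : I * 'I_n) : M := ts_in p.1 (b p.2).
exists #|{: I * 'I_n}|, (fun j => b' (enum_val j)) => m.
have /choice[c cP] : forall i, exists c : 'I_n -> k,
    ts_out i m = \sum_(j < n) (scal (c j) : A) *: b j by move=> i; apply: bP.
exists (fun j => c (enum_val j).1 (enum_val j).2).
rewrite -(big_enum_val (fun p : I * 'I_n => (scal (c p.1 p.2) : A) *: b' p)).
rewrite (eq_bigl xpredT) // -(pair_bigA _ (fun i j => (scal (c i j) : A) *: b' (i, j))) /=.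
rewrite [LHS]ts_in_out; apply: eq_bigr => i _.
have i_lin := semilinear_klin (ts_in_semilinear i).
by rewrite cP (klin_sum i_lin); apply: eq_bigr => j _; rewrite (klinZ i_lin).
Qed.

End TwistSum.

(** * Induction from a subgroup: unit, retraction, coset decomposition *)

Section SkewRestriction.
Variables (k : closedFieldType) (A : kalgType k) (gT : finGroupType).
Variable act : alg_action A gT.

Lemma skew_ind (G : {group gT}) (P : skew_alg act G -> Prop) :
  P 0 -> (forall s t, P s -> P t -> P (s + t)) ->
  (forall g a, g \in G -> P (sk act (subg G g) a)) -> forall s, P s.
Proof.
move=> P0 PD Psk s; rewrite [s]sk_sum; elim/big_ind: _ => // g _.
by rewrite -[g in sk _ g]sgvalK; apply: Psk; apply: subgP.
Qed.

Lemma sk_mul_subg (G : {group gT}) g h a b : g \in G -> h \in G ->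
  sk act (subg G g) a * sk act (subg G h) b =
  sk act (subg G (g * h)) (act h^-1%g a * b).
Proof.
move=> gG hG; rewrite sk_mulE subgK //; congr sk.
by apply: val_inj; rewrite /= !subgK ?groupM.
Qed.

Variables G H : {group gT}.
Hypothesis sHG : H \subset G.
Local Notation incl := (sk_incl act G H).

Lemma sk_incl0 : incl 0 = 0.
Proof.
by have := sk_incl_is_additive (act := act) G (0 : skew_alg act H) 0; rewrite !subrr.
Qed.
Lemma sk_inclD s t : incl (s + t) = incl s + incl t.
Proof.
rewrite /sk_incl -big_split; apply: eq_bigr => h _.
by rewrite ffunE raddfD.
Qed.
Lemma sk_incl_sk h a : h \in H -> incl (sk act (subg H h) a) = sk act (subg G h) a.
Proof.
move=> hH; rewrite /sk_incl (bigD1 (subg H h)) //= big1 ?addr0 => [|x neq].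
  by rewrite ffunE eqxx subgK.
by rewrite ffunE (negPf neq) raddf0.
Qed.

(** The projection of $AG$ onto $AH$ that drops the terms outside [H]. It splits the inclusion and
    is linear over $AH$ on both sides. *)
Definition sk_res (s : skew_alg act G) : skew_alg act H :=
  [ffun h => s (subg G (sgval h))].

Lemma sk_res0 : sk_res 0 = 0.
Proof. by apply/ffunP=> h; rewrite !ffunE. Qed.
Lemma sk_resD s t : sk_res (s + t) = sk_res s + sk_res t.
Proof. by apply/ffunP=> h; rewrite !ffunE. Qed.
Lemma sk_res_sk g a : g \in G ->
  sk_res (sk act (subg G g) a) = if g \in H then sk act (subg H g) a else 0.
Proof.
move=> gG; apply/ffunP=> h; rewrite !ffunE.
have -> : (subg G (sgval h) == subg G g) = (sgval h == g).
  by rewrite -(inj_eq val_inj) /= !subgK // (subsetP sHG) // subgP.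
case: ifP => [/eqP <-|hg]; first by rewrite subgP ffunE sgvalK eqxx.
case: ifP => gH; rewrite ffunE // ifN //; apply: contraFneq hg => ->.
by rewrite subgK.
Qed.

(** Right multiplication by an element of [H] preserves both [H] and its complement. *)
Lemma sk_res_inclr s r : sk_res (s * incl r) = sk_res s * r.
Proof.
elim/skew_ind: s => [|s t Is It|g a gG].
- by rewrite mul0r sk_res0 mul0r.
- by rewrite mulrDl !sk_resD mulrDl Is It.
elim/skew_ind: r => [|s t Is It|h b hH].
- by rewrite sk_incl0 mulr0 sk_res0 mulr0.
- by rewrite sk_inclD mulrDr !sk_resD mulrDr Is It.
have hG := subsetP sHG h hH.
rewrite sk_incl_sk // sk_mul_subg // !sk_res_sk ?(groupM gG hG) // groupMr //.
by case: ifP => gH; rewrite ?mul0r // sk_mul_subg.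
Qed.

Lemma sk_res_incll s r : sk_res (incl r * s) = r * sk_res s.
Proof.
elim/skew_ind: s => [|s t Is It|g a gG].
- by rewrite mulr0 sk_res0 mulr0.
- by rewrite mulrDr !sk_resD mulrDr Is It.
elim/skew_ind: r => [|s t Is It|h b hH].
- by rewrite sk_incl0 mul0r sk_res0 mul0r.
- by rewrite sk_inclD mulrDl !sk_resD mulrDl Is It.
have hG := subsetP sHG h hH.
rewrite sk_incl_sk // sk_mul_subg // !sk_res_sk ?(groupM hG gG) // groupMl //.
by case: ifP => gH; rewrite ?mulr0 // sk_mul_subg.
Qed.

Variable N : lmodType (skew_alg act H).
Local Notation V := (induced G N : lmodType (skew_alg act G)).
Local Notation SL := (semilinear act).

Definition ind_in (n : N) : induced G N := itens 1 n.
(** The component at the trivial coset, a retraction of the unit [ind_in]. *)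
Definition ind_out (t : induced G N) : N := tlift (fun s n => sk_res s *: n) t.

Lemma ind_out_tens s n : ind_out (itens s n) = sk_res s *: n.
Proof.
apply: tlift_tens => [s1 s2 m|s1 m1 m2|s1 r m].
- by rewrite sk_resD scalerDl.
- by rewrite scalerDr.
by rewrite /ind_ra /ind_la sk_res_inclr scalerA.
Qed.

Lemma ind_outB : zmod_morphism ind_out.
Proof.
apply: tlift_is_additive => [s1 s2 m|s1 m1 m2|s1 r m].
- by rewrite sk_resD scalerDl.
- by rewrite scalerDr.
by rewrite /ind_ra /ind_la sk_res_inclr scalerA.
Qed.

Lemma ind_scaleE s s' n : s *: (itens s' n : V) = itens (s * s') n.
Proof. exact: ind_scale_tens. Qed.

Lemma itens_incl s r n : itens (s * incl r) n = itens s (r *: n) :> induced G N.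
Proof. exact: tens_bal. Qed.

Lemma ind_out_incl r (t : V) : ind_out (incl r *: t) = r *: ind_out t.
Proof.
elim/induced_ind: t => [s n|t u It Iu].
  by rewrite ind_scaleE !ind_out_tens sk_res_incll scalerA.
by rewrite (scalerBr (incl r) (t : V) u) !ind_outB It Iu scalerBr.
Qed.

Lemma ind_in_incl r n : ind_in (r *: n) = incl r *: (ind_in n : V).
Proof. by rewrite ind_scaleE mulr1 -[incl r in RHS]mul1r itens_incl. Qed.

Lemma ind_inB : zmod_morphism ind_in.
Proof.
move=> m n; apply/eqP; rewrite eq_sym subr_eq /ind_in.
by rewrite -[itens _ _ + _]tensDr subrK.
Qed.

Lemma sk_incl_base a : incl (sk_base act H a) = sk_base act G a.
Proof.
rewrite /sk_base -(_ : subg H 1 = 1%g) ?sk_incl_sk //; last first.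
  by apply: val_inj; rewrite /= subgK.
by congr sk; apply: val_inj; rewrite /= subgK.
Qed.

Lemma ind_in_semilinear : SL 1 (ind_in : restrict N -> restrict V).
Proof.
split=> [x y|a x]; first exact: ind_inB.
rewrite aact1; transitivity (ind_in (sk_base act H a *: (x : N))) => //.
by rewrite ind_in_incl sk_incl_base.
Qed.

Lemma ind_out_semilinear : SL 1 (ind_out : restrict V -> restrict N).
Proof.
split=> [x y|a x]; first exact: ind_outB.
rewrite aact1; transitivity (ind_out (sk_base act G a *: (x : V))) => //.
by rewrite -sk_incl_base ind_out_incl.
Qed.

Lemma ind_in_gmul h n : h \in H -> ind_in (gmul h n) = gmul h (ind_in n : V).
Proof. by move=> hH; rewrite /gmul ind_in_incl sk_incl_sk. Qed.

Lemma ind_out_gmul h (t : V) : h \in H -> ind_out (gmul h t) = gmul h (ind_out t).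
Proof. by move=> hH; rewrite /gmul -ind_out_incl sk_incl_sk. Qed.

Lemma ind_out_gmul_in g n : g \in G ->
  ind_out (gmul g (ind_in n : V)) = if g \in H then gmul g n else 0.
Proof.
move=> gG; rewrite /gmul /ind_in ind_scaleE mulr1 ind_out_tens sk_res_sk //.
by case: ifP => _; rewrite ?scale0r.
Qed.

Lemma gmul_itens g h a n : g \in G -> h \in G ->
  gmul g (itens (sk act (subg G h) a) n : V) = itens (sk act (subg G (g * h)) a) n.
Proof.
move=> gG hG. apply: (etrans (ind_scaleE (sk act (subg G g) 1) (sk act (subg G h) a) n)).
rewrite (sk_mul_subg _ _ gG hG).
by rewrite (rmorph1 (act h^-1%g)) mul1r.
Qed.

Lemma gmul_ind_in g h a n : g \in G -> h \in H ->
  gmul g (ind_in (sk act (subg H h) a *: n) : V) =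
  itens (sk act (subg G (g * h)) a) n.
Proof.
move=> gG hH; have hG := subsetP sHG h hH.
by rewrite ind_in_incl sk_incl_sk // ind_scaleE mulr1 gmul_itens.
Qed.

Variable T : {set gT}.
Hypothesis T_trans : is_transversal T (lcosets H G) G.
Local Notation I := {t | t \in T}.

(** By additivity it suffices to treat $ga \otimes n$. Only the representative [t] of $gH$
    contributes, and $t^{-1}ga \in AH$ moves across the tensor sign. *)
Lemma ind_decomp (t : V) :
  t = \sum_(i : I) gmul (val i) (ind_in (ind_out (gmul (val i)^-1 t)) : V).
Proof.
have [sTG Tuniq] := left_transversalP T_trans.
have in_lin := semilinear_klin ind_in_semilinear.
have out_lin := semilinear_klin ind_out_semilinear.
have gB g (u v : V) : gmul g (u - v) = gmul g u - gmul g v by exact: scalerBr.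
elim/induced_ind: t => [s n|t u It Iu]; last first.
  rewrite {1}It {1}Iu -sumrB; apply: eq_bigr => i _.
  by rewrite !gB ind_outB ind_inB gB.
elim/skew_ind: s => [|s t Is It|g a gG].
- have z0 : itens 0 n = 0 :> V.
    by have := ind_scaleE 0 1 n; rewrite mul0r scale0r => <-.
  rewrite z0 big1 // => i _; rewrite /gmul scaler0.
  by rewrite (klin0 out_lin) (klin0 in_lin) scaler0.
- have zD : itens (s + t) n = itens s n + itens t n :> V by exact: tensDl.
  rewrite zD {1}Is {1}It -big_split; apply: eq_bigr => i _.
  have gD g (u v : V) : gmul g (u + v) = gmul g u + gmul g v by exact: scalerDr.
  by rewrite !gD /= (klinD out_lin) (klinD in_lin) gD.
have [i [iH i_uniq]] := Tuniq g gG.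
rewrite (bigD1 i) //= big1 ?addr0 => [|j neq].
  have iG : val i \in G by apply/sTG/(valP i).
  rewrite gmul_itens ?groupV // ind_out_tens sk_res_sk ?(groupM (groupVr iG) gG) //.
  by rewrite iH (gmul_ind_in _ _ iG iH) mulKVg.
have jG : val j \in G by apply/sTG/(valP j).
rewrite gmul_itens ?groupV // ind_out_tens sk_res_sk ?(groupM (groupVr jG) gG) //.
rewrite ifN; first by rewrite scale0r (klin0 in_lin) /gmul scaler0.
by apply: contraNN neq => /i_uniq ->.
Qed.

(** Frobenius reciprocity: compatibility with [A] and with [H] makes [j] linear over $AH$, so $s
    \otimes n \mapsto s j(n)$ is balanced. *)
Lemma ind_universal (Y : lmodType (skew_alg act G)) (j : N -> Y) :
  SL 1 (j : restrict N -> restrict Y) ->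
  {in H, forall h n, j (gmul h n) = gmul h (j n)} ->
  exists J : {linear V -> Y}, forall n, J (ind_in n) = j n.
Proof.
move=> jS jH; have j_lin := semilinear_klin jS.
have jr r n : j (r *: n) = incl r *: j n.
  elim/skew_ind: r => [|s t Is It|h a hH].
  - by rewrite sk_incl0 !scale0r (klin0 j_lin).
  - by rewrite sk_inclD !scalerDl -Is -It -(klinD j_lin).
  rewrite sk_incl_sk // !sk_gmul jH //; congr gmul.
  by have := proj2 jS a n; rewrite aact1.
pose b s n := s *: j n.
have bDl s1 s2 n : b (s1 + s2) n = b s1 n + b s2 n by apply: scalerDl.
have bDr s m n : b s (m + n) = b s m + b s n by rewrite /b (klinD j_lin) scalerDr.
have bb s r n : b (ind_ra s r) n = b s (ind_la r n).
  by rewrite /b /ind_ra /ind_la jr scalerA.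
pose Jf : V -> Y := tlift b.
have JE s n : Jf (itens s n) = s *: j n by apply: tlift_tens.
have JB : zmod_morphism Jf by apply: tlift_is_additive.
have Jlin : linear Jf.
  pose JA : {additive V -> Y} :=
    HB.pack Jf (GRing.isZmodMorphism.Build V Y Jf JB).
  have JD (t u : V) : Jf (t + u) = Jf t + Jf u by apply: (raddfD JA).
  move=> s t u; rewrite JD; congr (_ + _).
  elim/induced_ind: t => [s' n|t t' It It']; first by rewrite ind_scaleE !JE scalerA.
  by rewrite (scalerBr s (t : V) t') !JB It It' scalerBr.
have [J JfE] := linear_bundle Jlin.
by exists J => n; rewrite JfE JE scale1r.
Qed.

(** The translates of the trivial-coset component by the representatives are the twists of [X]. *)
Lemma restrict_induced (X : lmodType A) :
  iso (restrict N) X -> iso (restrict V) (twist_sum act T X).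
Proof.
case=> f /bijective_inverse[f' fK f'K].
have [sTG _] := left_transversalP T_trans.
have fS := linear_semilinear act f.
have f'S : SL 1 f' by rewrite -[1%g]invg1; apply: semilinear_inv fS fK f'K.
apply: iso_sym.
pose F (m : twist_sum act T X) : V :=
  \sum_(i : I) gmul (val i) (ind_in (f' (ts_out i m)) : V).
have FS : SL 1 (F : twist_sum act T X -> restrict V).
  apply: semilinear_sum => i _.
  have iG : val i \in G by apply/sTG/(valP i).
  rewrite -(mulgV (val i)); apply: semilinear_comp (gmul_semilinear V iG) _.
  rewrite -[(_^-1)%g]mul1g; apply: semilinear_comp ind_in_semilinear _.
  rewrite -[(_^-1)%g]mul1g; apply: semilinear_comp f'S _.
  exact: ts_out_semilinear.
apply: (@iso_by _ _ _ (F : twist_sum act T X -> restrict V)).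
  exact: semilinear_linear FS.
(* Translation by $i^{-1}$ brings the component at [i] to the trivial coset and every other one to a
   nontrivial coset, where [ind_out] vanishes. *)
have outF i m : ind_out (gmul (val i)^-1 (F m)) = f' (m i).
  have iG : val i \in G by apply/sTG/(valP i).
  have gS := gmul_semilinear V (groupVr iG).
  rewrite (klin_sum (semilinear_klin gS)).
  rewrite (klin_sum (semilinear_klin ind_out_semilinear)).
  have out j : ind_out (gmul (val i)^-1 (gmul (val j) (ind_in (f' (ts_out j m)) : V)))
     = if j == i then f' (m i) else 0.
    have jG : val j \in G by apply/sTG/(valP j).
    rewrite -gmulM ?groupV // ind_out_gmul_in ?(groupM (groupVr iG) jG) //.
    have [->|neq] := eqVneq j i; first by rewrite mulVg group1 gmul1.
    rewrite ifN //; apply: contra neq => ijH.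
    have [i0 [_ i0_uniq]] := (left_transversalP T_trans).2 _ jG.
    by rewrite (i0_uniq i ijH) (i0_uniq j) ?mulVg.
  rewrite (eq_bigr _ (fun j _ => out j)) (bigD1 i) //= big1 ?addr0 ?eqxx // => j.
  by move/negPf->.
exists (fun z => [ffun i : I => (f (ind_out (gmul (val i)^-1 (z : V))) : twist act (val i) X)]).
  by move=> m; apply/ffunP=> i; rewrite ffunE outF f'K.
move=> z; rewrite [RHS](ind_decomp z); apply: eq_bigr => i _.
by rewrite /ts_out ffunE fK.
Qed.

End SkewRestriction.

(** * Characters of an abelian group *)

Section Characters.
Variables (k : closedFieldType) (gT : finGroupType) (H : {group gT}).
Local Notation kH := (group_alg k H).

(** A one dimensional representation with a basis vector and its character; the values of [chi]
    outside [H] are arbitrary. *)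
Definition affords (L : lmodType kH) (v : L) (chi : gT -> k) :=
  [/\ v <> 0, forall l : L, exists c, l = (scal c : kH) *: v
    & {in H, forall h, gmul h v = (scal (chi h) : kH) *: v}].

Lemma gmul_k_linear (L : lmodType kH) (h : gT) : k_linear (@gmul k _ gT _ H L h).
Proof.
by split=> [x y|c x]; rewrite /gmul ?scalerBr // !scalerA scalC.
Qed.

(** The commuting operators of [H] have a common eigenvector, found one group element at a time; its
    line is a submodule, hence everything. *)
Lemma irreducible_affords (L : lmodType kH) : abelian H -> irreducible L ->
  exists v chi, @affords L v chi.
Proof.
move=> abH [L0 Lirr].
have gmulC : {in H &, forall g h (x : L), gmul g (gmul h x) = gmul h (gmul g x)}.
  by move=> g h gH hH x; rewrite -!gmulM // (centsP abH g gH h hH).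
have [v v0 veig] : exists2 v : L, v <> 0 &
    {in H, forall h, exists c, gmul h v = (scal c : kH) *: v}.
  suff [v v0 veig] : exists2 v : L, v <> 0 &
      {in enum H, forall h, exists c, gmul h v = (scal c : kH) *: v}.
    by exists v => // h hH; apply: veig; rewrite mem_enum.
  have: {subset enum H <= H} by move=> h; rewrite mem_enum.
  elim: (enum _) => [_|h s IHs sH].
    have [v v0] : exists v : L, v <> 0.
      apply: contrapT => nex; apply: L0 => x.
      by apply: contrapT => x0; apply: nex; exists x.
    by exists v.
  have hH : h \in H by apply: sH; rewrite mem_head.
  have [|v v0 veig] := IHs; first by move=> g gs; apply: sH; rewrite inE gs orbT.
  (* The order of [h] provides the annihilating polynomial from which an eigenvector is
     extracted. *)
  pose p : {poly k} := 'X^#[h]%g - 1.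
  have p0 : p != 0.
    by rewrite -size_poly_eq0 size_XnsubC ?order_gt0.
  have pv : peval (@gmul _ _ _ _ _ L h) p v = 0.
    have -> : p = 'X^#[h]%g + (-1)%:P by rewrite /p polyCN.
    rewrite pevalD peval_Xn pevalC rmorphN rmorph1 scaleN1r.
    suff -> : iter #[h]%g (@gmul _ _ _ _ _ L h) v = gmul (h ^+ #[h]%g)%g v.
      by rewrite expg_order gmul1 subrr.
    elim: #[h]%g => [|n IHn]; first by rewrite expg0 gmul1.
    by rewrite iterS IHn expgS gmulM // groupX.
  have [q [c [w0 wh]]] := peval_eigenvector (gmul_k_linear L h) p0 v0 pv.
  exists (peval (@gmul _ _ _ _ _ L h) q v) => // g; rewrite inE => /orP[/eqP->|gs].
    by exists c.
  have gH : g \in H by apply: sH; rewrite inE gs orbT.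
  have [d gd] := veig g gs; exists d.
  (* Passing from [v] to $q(h)v$ keeps the earlier eigenvalues, because [g] commutes with $q(h)$. *)
  rewrite -(peval_comm _ _ (gmul_k_linear L g)); last by move=> y; apply: gmulC.
  by rewrite gd (klinZ (peval_linear (gmul_k_linear L h) q)).
have /choice[chi chiP] : forall h, exists c, h \in H -> gmul h v = (scal c : kH) *: v.
  move=> h; have [/veig[c cP]|hH] := boolP (h \in H); first by exists c.
  by exists 0.
exists v, chi; split=> // l.
pose U (l : L) := exists c, l = (scal c : kH) *: v.
have UD x y : U x -> U y -> U (x + y).
  by move=> [c ->] [d ->]; exists (c + d); rewrite raddfD scalerDl.
have UZ a x : U x -> U (a *: x).
  move=> [c ->]; elim/skew_ind: a => [|s t Is It|g a gH].
  - by exists 0; rewrite raddf0 !scale0r.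
  - by rewrite scalerDl; apply: UD.
  exists (a * c * chi g); rewrite sk_gmul (klinZ (gmul_k_linear L g)).
  by rewrite (klinZ (gmul_k_linear L g)) chiP // !scalerA -!rmorphM.
have [|a x y Ux Uy|U0|Ul] := Lirr U; last exact: Ul; first by exists 0; rewrite raddf0 scale0r.
  by apply: UD => //; apply: UZ.
by case: v0; apply: U0; exists 1; rewrite rmorph1 scale1r.
Qed.

Lemma affords_cancel (L : lmodType kH) (v : L) chi c : affords v chi ->
  (scal c : kH) *: v = 0 -> c = 0.
Proof.
case=> v0 _ _ cv; have [//|c0] := eqVneq c 0; case: v0.
by rewrite -[v]scale1r -(rmorph1 (@scal k kH)) -(mulVf c0) rmorphM -scalerA cv scaler0.
Qed.

Lemma affords_eigen (L : lmodType kH) (v l : L) chi (psi : gT -> k) :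
  affords v chi -> l <> 0 ->
  {in H, forall h, gmul h l = (scal (psi h) : kH) *: l} -> {in H, chi =1 psi}.
Proof.
move=> vP l0 leig h hH; have [_ vspan veig] := vP; have [c lE] := vspan l.
have c0 : c != 0.
  by apply/eqP => c0; apply: l0; rewrite lE c0 raddf0 scale0r.
have := leig h hH; rewrite lE (klinZ (gmul_k_linear L h)) veig // !scalerA -!rmorphM.
move/eqP; rewrite -subr_eq0 -scalerBl -rmorphB => /eqP/(affords_cancel vP)/eqP.
by rewrite [psi h * c]mulrC -mulrBr mulf_eq0 (negPf c0) subr_eq0 => /eqP.
Qed.

Lemma group_alg_skE (g : subg_of H) (a : k) (w : kH) (x : subg_of H) :
  (sk (trivial_action k gT) g a * w) x = a * w (g^-1 * x)%g.
Proof.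
transitivity (sk_mul (sk (trivial_action k gT) g a) w x) => //.
rewrite ffunE (bigD1 (g^-1 * x)%g) //= big1 ?addr0 => [|h neq].
  by rewrite ffunE invMg invgK mulgA mulgV mul1g eqxx.
rewrite ffunE ifN ?mul0r //; apply: contraNneq neq => <-.
by rewrite invMg invgK mulgKV.
Qed.

Section Decomposition.
Variables (I : finType) (rho : I -> lmodType kH) (v : forall i, rho i).
Variable chi : I -> gT -> k.
Hypothesis v_affords : forall i, affords (v i) (chi i).
Hypothesis rho_regular : iso (kH^o : lmodType kH) (dsum rho).

(** An eigenvector of character [psi] in the regular representation has a nonzero component in some
    [rho i], whose character must then be [psi]. *)
Lemma character_occurs (psi : gT -> k) : psi 1%g = 1 ->
  {in H &, {morph psi : g h / (g * h)%g >-> g * h}} ->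
  exists i, {in H, chi i =1 psi}.
Proof.
move=> psi1 psiM; have [F /bijective_inverse[F' FK F'K]] := rho_regular.
have psi0 h : h \in H -> psi h != 0.
  move=> hH; apply/eqP => h0; have /eqP := psiM h h^-1%g hH (groupVr hH).
  by rewrite mulgV psi1 h0 mul0r oner_eq0.
(* The element $\sum_h \psi(h)^{-1} h$, a multiple of the usual idempotent of [psi]. *)
pose e : kH := [ffun h : subg_of H => (psi (sgval h))^-1].
have e0 : F e <> 0.
  rewrite -(raddf0 F) => /(can_inj FK)/ffunP/(_ 1%g); rewrite !ffunE /= psi1 invr1.
  by apply/eqP/oner_neq0.
have [i li0] : exists i, F e i <> 0.
  apply: contrapT => nex; apply: e0; apply/ffunP => i; rewrite ffunE.
  by apply: contrapT => ei; apply: nex; exists i.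
have eE h : h \in H -> gmul h (e : kH^o) = (scal (psi h) : kH) *: (e : kH^o).
  move=> hH; apply/ffunP => x; rewrite [LHS]group_alg_skE [RHS]group_alg_skE.
  rewrite !ffunE /= mul1r invg1 mul1g psiM ?groupV ?subgK ?subgP //.
  have := psiM h h^-1%g hH (groupVr hH); rewrite mulgV psi1 => hV.
  rewrite invfM; congr (_ * _); rewrite -[RHS](mulfK (psi0 _ (groupVr hH))).
  by rewrite -hV mul1r.
exists i; apply: (affords_eigen (v_affords i) li0) => h hH.
transitivity (gmul h (F e) i); first by rewrite /gmul ffunE.
transitivity (((scal (psi h) : kH) *: F e) i); last by rewrite ffunE.
by rewrite -linear_gmul eE // linearZZ.
Qed.

(* A character has multiplicity one in kH: an eigenvector of kH is determined by
   its coefficient at 1. *)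
Lemma characters_distinct i j : {in H, chi i =1 chi j} -> i = j.
Proof.
move=> chi_ij; have [F /bijective_inverse[F' FK F'K]] := rho_regular.
pose d i0 : dsum rho := [ffun j0 => if j0 == i0 then v j0 else 0].
have dE i0 h : h \in H -> gmul h (d i0) = (scal (chi i0 h) : kH) *: d i0.
  move=> hH; apply/ffunP => j0; rewrite !ffunE; case: eqP => [->|_].
    by have [_ _] := v_affords i0; apply.
  by rewrite !scaler0.
pose w i0 : kH := F' (d i0).
have wF i0 : F (w i0) = d i0 by apply: F'K.
have w0 i0 : w i0 <> 0.
  move=> wi; have := wF i0; rewrite wi raddf0 => /ffunP/(_ i0).
  by rewrite !ffunE eqxx => /esym; case: (v_affords i0).
have wg i0 h : h \in H -> w i0 (subg H h)^-1%g = chi i0 h * w i0 1%g.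
  move=> hH; have : gmul h (w i0 : kH^o) = (scal (chi i0 h) : kH) *: (w i0 : kH^o).
    by apply: (can_inj FK); rewrite linear_gmul linearZZ wF dE.
  move=> /ffunP/(_ 1%g); rewrite [LHS]group_alg_skE [RHS]group_alg_skE.
  by rewrite mulg1 mul1r invg1 mul1g.
have wx i0 x : w i0 x = chi i0 (sgval x^-1%g) * w i0 1%g.
  by rewrite -wg ?subgP // sgvalK invgK.
have w1 i0 : w i0 1%g != 0.
  by apply/eqP => wi; apply: (w0 i0); apply/ffunP => x; rewrite wx wi mulr0 ffunE.
(* Both sides are eigenvectors of the same character with the same coefficient at 1. Their images
   are nonzero multiples of [d i] and [d j], which forces [i = j]. *)
have ww : (scal (w j 1%g) : kH) *: (w i : kH^o) = (scal (w i 1%g) : kH) *: (w j : kH^o).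
  apply/ffunP => x; rewrite [LHS]group_alg_skE [RHS]group_alg_skE invg1 mul1g.
  by rewrite (wx i x) (wx j x) chi_ij ?subgP // mulrCA [RHS]mulrCA [w i _ * _]mulrC.
have := congr1 F ww; rewrite !linearZZ !wF => /ffunP/(_ i); rewrite !ffunE eqxx.
case: eqP => [//|_]; rewrite scaler0 => /(affords_cancel (v_affords i))/eqP.
by rewrite (negPf (w1 j)).
Qed.
End Decomposition.
End Characters.

(** * Tensoring with a one dimensional representation *)

Section TensorCharacter.
Variables (k : closedFieldType) (A : kalgType k) (gT : finGroupType).
Variables (act : alg_action A gT) (H : {group gT}).
Variables (L : lmodType (group_alg k H)) (v : L) (chi : gT -> k).
Hypothesis v_affords : affords v chi.
Variable N : lmodType (skew_alg act H).
Local Notation LN := (rep_tensor L N : lmodType (skew_alg act H)).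

Lemma rtens_scal (c : k) (x : N) :
  rtens ((scal c : group_alg k H) *: v) x = rtens v ((scal c : skew_alg act H) *: x) :> LN.
Proof. exact: tens_bal. Qed.

(** The inverse sends $l \otimes x$ to $c(l) x$, where $c(l)$ is the coordinate of [l] along [v]. *)
Lemma rtens_bij : bijective (rtens v : N -> LN).
Proof.
have [v0 vspan _] := v_affords.
have /choice[c cP] := vspan.
have c_eq l d : l = (scal d : group_alg k H) *: v -> c l = d.
  move=> lE; apply/eqP; rewrite -subr_eq0; apply/eqP/(affords_cancel v_affords).
  by rewrite raddfB scalerBl -cP -lE subrr.
pose b l (x : N) : N := (scal (c l) : skew_alg act H) *: x.
have bDl l m x : b (l + m) x = b l x + b m x.
  rewrite /b (_ : c (l + m) = c l + c m) ?raddfD ?scalerDl //.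
  by apply: c_eq; rewrite raddfD scalerDl -!cP.
have bDr l x y : b l (x + y) = b l x + b l y by apply: scalerDr.
have b_bal l d x : b (rep_ra l d) x = b l (rep_la d x).
  rewrite /b /rep_ra /rep_la (_ : c _ = c l * d) ?rmorphM ?scalerA //.
  by apply: c_eq; rewrite {1}(cP l) scalerA -rmorphM mulrC.
have lE l x : tlift b (rtens l x) = (scal (c l) : skew_alg act H) *: x.
  by apply: (tlift_tens bDl bDr b_bal).
exists (tlift b : LN -> N) => [x|].
  by rewrite lE (c_eq v 1) ?rmorph1 ?scale1r.
elim/rep_tensor_ind => [l x|t u It Iu]; first by rewrite lE -rtens_scal -cP.
have bB : zmod_morphism (tlift b : LN -> N) by apply: (tlift_is_additive bDl bDr b_bal).
by rewrite bB raddfB /= It Iu.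
Qed.

Lemma rtens_semilinear : semilinear act 1 (rtens v : restrict N -> restrict LN).
Proof.
split=> [x y|a x]; first exact: (raddfB (rtens v)).
rewrite aact1; transitivity (sk_base act H a *: (rtens v x : LN)) => //.
transitivity (rtens (sk (trivial_action k gT) (1%g : subg_of H) 1 *: v)
  (sk act (1%g : subg_of H) a *: (x : N))); last first.
  by apply/esym; apply: rep_scale_sk.
by rewrite -[sk _ _ 1]/(1 : group_alg k H) scale1r.
Qed.

Lemma gmul_rtens h x : h \in H ->
  gmul h (rtens v x : LN) = (scal (chi h) : A) *: (rtens v (gmul h x) : restrict LN).
Proof.
move=> hH; have [_ _ veig] := v_affords.
transitivity (rtens (gmul h v) (gmul h x)); first exact: rep_scale_sk.
rewrite veig // rtens_scal.
exact: (klinZ (semilinear_klin rtens_semilinear) (chi h) (gmul h x)).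
Qed.

End TensorCharacter.

(** * Modules above a given indecomposable *)

Section Clifford.
Variables (k : closedFieldType) (A : kalgType k) (gT : finGroupType).
Variables (act : alg_action A gT) (G : {group gT}) (X : lmodType A).
Hypotheses (X_fin : fin_dim X) (X_indec : indecomposable X).
Local Notation H := (inertia act G X).
Local Notation SL := (semilinear act).
Variable T : {set gT}.
Hypothesis T_trans : is_transversal T (lcosets H G) G.
Local Notation I := {t | t \in T}.

Let sHG : H \subset G.
Proof. by apply/subsetP=> g; rewrite inE => /andP[]. Qed.

Let sTG (i : I) : val i \in G.
Proof. by apply/(left_transversalP T_trans).1/(valP i). Qed.

Let T_off (i j : I) : i != j -> ((val i)^-1 * val j)%g \notin H.
Proof.
move=> neq; apply: contra neq => ijH.
have [i0 [_ i0_uniq]] := (left_transversalP T_trans).2 _ (sTG j).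
by rewrite (i0_uniq i ijH) (i0_uniq j) ?mulVg.
Qed.

(** Such an [f] is an isomorphism from the twist of [X] by [g] to [X]. Contrapositively, maps of
    degree outside [H] are never invertible. *)
Lemma bij_inertia g (f : X -> X) : g \in G -> SL g f -> bijective f -> g \in H.
Proof.
move=> gG [fB fZ] fb; rewrite inE gG; apply/asboolP.
apply: (@iso_by _ (twist act g X) X f) => // a x y.
rewrite (klinD (semilinear_klin (conj fB fZ))).
by rewrite [X in f X]/(act g^-1%g a *: (x : X)) fZ -aactM mulgV aact1.
Qed.

(** Applying each [b s] gives a linear system with entries [b s \o a t]. Off the diagonal their
    degree $s^{-1}t$ lies outside [H], so [local_matrix_inj] applies. *)
Lemma orbit_sum_inj (Y : lmodType A) (a : I -> X -> Y) (b : I -> Y -> X)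
    (x : I -> X) :
  (forall i, SL (val i) (a i)) -> (forall i, SL (val i)^-1 (b i)) ->
  (forall i, bijective (b i \o a i)) ->
  \sum_i a i (x i) = 0 -> forall i, x i = 0.
Proof.
move=> aS bS ba sum0 i.
apply: (@local_matrix_inj _ _ _ act X X_fin X_indec _ val (index_enum I)
  (fun s t => b s \o a t)) => //.
- exact: index_enum_uniq.
- by move=> s t _ _; apply: semilinear_comp.
- move=> s t _ _ neq /(bij_inertia (groupM (groupVr (sTG s)) (sTG t))).
  by move/(_ (semilinear_comp (bS s) (aS t))); apply/negP/T_off.
- move=> s _; have bs := semilinear_klin (bS s).
  by rewrite -(klin_sum bs) sum0 (klin0 bs).
by rewrite mem_index_enum.
Qed.

Lemma inj_iso_bij (M Y Z : lmodType A) (J : Z -> Y) : fin_dim M ->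
  iso Z M -> iso Y M -> k_linear J -> injective J -> bijective J.
Proof.
move=> M_fin [p /bijective_inverse[p' pK p'K]] [q /bijective_inverse[q' qK q'K]] J_lin Jinj.
have lin (U V : lmodType A) (f : {linear U -> V}) : k_linear f.
  exact: semilinear_klin (linear_semilinear act f).
have p'_lin := semilinear_klin (semilinear_inv (linear_semilinear act p) pK p'K).
have : bijective (q \o (J \o p')).
  apply: (fin_dim_bij M_fin); last first.
    by left; apply: inj_comp; [apply: can_inj qK | apply: inj_comp; [exact: Jinj | apply: can_inj p'K]].
  split=> [x y|c x] /=.
    by rewrite (klinB p'_lin) (klinB J_lin) raddfB.
  by rewrite (klinZ p'_lin) (klinZ J_lin) (klinZ (lin _ _ q)).
move=> b; apply: (@eq_bij _ _ (q' \o (q \o (J \o p')) \o p)).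
  apply: bij_comp; last by exists p'.
  by apply: bij_comp => //; exists q.
by move=> z /=; rewrite pK qK.
Qed.

(** Invariance of [N] moves one summand of [N], the twist of [X] by [i], to the twists by all other
    representatives, and [orbit_sum_inj] makes the resulting sum direct. *)
Lemma invariant_orbit_summand (N : lmodType A) (i : I) (a : X -> N) (b : N -> X) :
  g_invariant act G N -> SL (val i) a -> SL (val i)^-1 b -> bijective (b \o a) ->
  exists2 J : twist_sum act T X -> N, SL 1 J & injective J.
Proof.
move=> N_inv aS bS ba.
(* An isomorphism from the twist of [N] by [g] is read as a bijection of [N] of degree [g]. *)
have /choice[th thP] : forall g, exists th : N -> N,
    g \in G -> SL g th /\ bijective th.
  move=> g; have [gG|gG] := boolP (g \in G); last by exists id.
  have [f fb] := N_inv g gG; exists f => _; split=> //.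
  split=> [x y|c x]; first exact: raddfB.
  rewrite -(linearZZ f); congr (f _).
  by rewrite [RHS]/(act g^-1%g (act g c) *: x) -aactM mulVg aact1.
have ijG (j : I) : (val j * (val i)^-1)%g \in G by exact: groupM (sTG j) (groupVr (sTG i)).
pose aa (j : I) := th (val j * (val i)^-1)%g \o a.
have aaS j : SL (val j) (aa j).
  have <- : (val j * (val i)^-1 * val i)%g = val j := mulgKV _ _.
  by apply: semilinear_comp aS; case: (thP _ (ijG j)).
have /choice[bb bbP] : forall j, exists bb : N -> X,
    SL (val j)^-1 bb /\ bijective (bb \o aa j).
  move=> j; have [thS /bijective_inverse[th' thK th'K]] := thP _ (ijG j).
  exists (b \o th'); split; last by apply: (eq_bij ba) => x /=; rewrite thK.
  rewrite -[(_^-1)%g](mulKg (val i)); apply: semilinear_comp bS _.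
  by rewrite -[val i]invgK -invMg; apply: semilinear_inv thS thK th'K.
have JS : SL 1 (fun m : twist_sum act T X => \sum_j aa j (ts_out j m)).
  apply: semilinear_sum => j _; rewrite -(mulgV (val j)).
  by apply: semilinear_comp (aaS j) (ts_out_semilinear _ _ _).
exists (fun m : twist_sum act T X => \sum_j aa j (ts_out j m)) => //.
apply: (klin_inj (semilinear_klin JS)) => m m0; apply/ffunP=> j.
rewrite ffunE; apply: (orbit_sum_inj (b := bb) aaS _ _ m0) => j'.
  by case: (bbP j').
by case: (bbP j').
Qed.

(** The identity of one summand is a sum of maps through [N] and through [P], so one of these is
    invertible. The whole orbit sum then embeds in that factor, and the dimension kills the other
    one. *)
Lemma twist_sum_indecomposable :
  g_invariant act G (twist_sum act T X) ->
  indecomposable_g_invariant act G (twist_sum act T X).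
Proof.
move=> M_inv.
have [i _] := (left_transversalP T_trans).2 _ (group1 G).
split=> // [M0|N P N_inv P_inv [F /bijective_inverse[F' FK F'K]]].
  case: X_indec => + _; apply=> x.
  by rewrite -(ts_out_in act i x) (M0 (ts_in act i x)) /ts_out ffunE.
have FS := linear_semilinear act F.
have F'S : SL 1 F' by rewrite -[1%g]invg1; apply: semilinear_inv FS FK F'K.
have F'_lin := semilinear_klin F'S.
have inNS : SL 1 (fun n : N => (n, 0) : N * P).
  by split=> [x y|c x]; rewrite ?aact1; congr pair; rewrite ?subrr ?scaler0.
have inPS : SL 1 (fun p : P => (0, p) : N * P).
  by split=> [x y|c x]; rewrite ?aact1; congr pair; rewrite ?subrr ?scaler0.
have fstS : SL 1 (fst : N * P -> N) by split=> // c x; rewrite aact1.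
have sndS : SL 1 (snd : N * P -> P) by split=> // c x; rewrite aact1.
have aS (U : lmodType A) (pr : N * P -> U) : SL 1 pr ->
    SL (val i) (pr \o (F \o ts_in act i)).
  move=> prS; rewrite -[val i]mul1g; apply: semilinear_comp prS _.
  by rewrite -[val i]mul1g; apply: semilinear_comp FS (ts_in_semilinear _ _ _).
have bS (U : lmodType A) (inj : U -> N * P) : SL 1 inj ->
    SL (val i)^-1 (ts_out i \o (F' \o inj)).
  move=> injS; rewrite -[((val i)^-1)%g]mulg1.
  apply: semilinear_comp (ts_out_semilinear _ _ _) _.
  by rewrite -[1%g]mulg1; apply: semilinear_comp F'S injS.
(* The composite of [J], [inj] and [F'] is an injective endomorphism of the orbit sum, hence
   surjective, and so [inj] is surjective. *)
have bij_in (U : lmodType A) (inj : U -> N * P) (J : twist_sum act T X -> U) :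
    SL 1 inj -> injective inj -> SL 1 J -> injective J ->
    forall y, exists u, inj u = y.
  move=> injS inj_inj JS J_inj y.
  have S1 : SL (1 * (1 * 1)) (F' \o (inj \o J)) by do 2!apply: semilinear_comp => //.
  have [||h _ hK] := @fin_dim_bij _ _ _ (twist_sum_fin_dim act T X_fin) (F' \o (inj \o J)).
  - exact: semilinear_klin S1.
  - by left; do 2!apply: inj_comp => //; apply: can_inj F'K.
  by exists (J (h (F' y))); apply: (can_inj F'K); apply: hK.
have [|||b|b] := @bijD _ _ _ act X X_fin X_indec ((val i)^-1 * val i)%g
  ((ts_out i \o (F' \o (fun n => (n, 0)))) \o (fst \o (F \o ts_in act i)))
  ((ts_out i \o (F' \o (fun p => (0, p)))) \o (snd \o (F \o ts_in act i))).
- exact: semilinear_comp (bS _ _ inNS) (aS _ _ fstS).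
- exact: semilinear_comp (bS _ _ inPS) (aS _ _ sndS).
- apply: (@eq_bij _ _ id) => [|x] /=; first by exists id.
  rewrite -(klinD (semilinear_klin (ts_out_semilinear act X i))) -(klinD F'_lin).
  rewrite (_ : _ + _ = F (ts_in act i x)) ?FK ?ts_out_in //.
  by case: (F _) => n p; congr pair; rewrite /= ?addr0 ?add0r.
- right=> p.
  have [J JS J_inj] := invariant_orbit_summand N_inv (aS _ _ fstS) (bS _ _ inNS) b.
  by have [|n [_ <-]] := bij_in _ _ J inNS _ JS J_inj (0, p); first by move=> n n' [].
left=> n.
have [J JS J_inj] := invariant_orbit_summand P_inv (aS _ _ sndS) (bS _ _ inPS) b.
by have [|p [<- _]] := bij_in _ _ J inPS _ JS J_inj (n, 0); first by move=> p p' [].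
Qed.

(** * The action of [H] on [X] and the induced modules *)

Variables (XH : lmodType (skew_alg act H)) (phi : {linear restrict XH -> X}).
Variable phi' : X -> restrict XH.
Hypotheses (phiK : cancel phi phi') (phi'K : cancel phi' phi).

(** [XH] restricts to [X] only up to [phi], so the action is transported along this isomorphism. *)
Definition hact (h : gT) (x : X) : X := phi (gmul h (phi' x : XH)).

Let phiS : SL 1 phi := linear_semilinear act phi.
Let phi'S : SL 1 phi'.
Proof. by rewrite -[1%g]invg1; apply: semilinear_inv phiS phiK phi'K. Qed.

Lemma hact_semilinear h : h \in H -> SL h (hact h).
Proof.
move=> hH; have -> : h = (1 * (h * 1))%g by rewrite mul1g mulg1.
apply: semilinear_comp phiS _; rewrite mul1g mulg1.
by rewrite -[h in semilinear act h]mulg1; apply: semilinear_comp (gmul_semilinear XH hH) phi'S.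
Qed.

Lemma hact1 x : hact 1 x = x.
Proof. by rewrite /hact gmul1 phi'K. Qed.

Lemma hactM : {in H &, forall g h x, hact (g * h)%g x = hact g (hact h x)}.
Proof. by move=> g h gH hH x; rewrite /hact phiK gmulM. Qed.

Lemma hactK : {in H, forall h, cancel (hact h) (hact h^-1)}.
Proof. by move=> h hH x; rewrite -hactM ?groupV // mulVg hact1. Qed.

Lemma hactVK : {in H, forall h, cancel (hact h^-1) (hact h)}.
Proof. by move=> h hH x; rewrite -hactM ?groupV // mulgV hact1. Qed.

(* Z = AG (x)_AH (chi (x) X), described through the unit eta : X -> Z and its
   retraction q; hact is the given action of H on X. *)
Record induced_data (Z : lmodType (skew_alg act G)) (chi : gT -> k)
    (eta : X -> restrict Z) (q : restrict Z -> X) : Prop := InducedData {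
  eta_semilinear : SL 1 eta;
  q_semilinear : SL 1 q;
  eta_gmul : {in H, forall h x,
    gmul h (eta x : Z) = (scal (chi h) : A) *: eta (hact h x)};
  q_gmul : {in H, forall h z, q (gmul h (z : Z)) = (scal (chi h) : A) *: hact h (q z)};
  q_eta : cancel eta q;
  data_decomp : forall z : Z,
    z = \sum_(i : I) gmul (val i) (eta (q (gmul (val i)^-1 z)) : Z);
  data_universal : forall (Y : lmodType (skew_alg act G)) (j : X -> restrict Y),
    SL 1 j ->
    {in H, forall h x, gmul h (j x : Y) = (scal (chi h) : A) *: j (hact h x)} ->
    exists J : {linear Z -> Y}, forall x, J (eta x) = j x;
  data_restrict : iso (restrict Z) (twist_sum act T X)
}.

(** Here [eta] is $x \mapsto 1 \otimes (v \otimes x)$, with [X] identified with [XH], and [q] reads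
    the trivial-coset component back in [X]. *)
Lemma induced_rep_tensor_data (L : lmodType (group_alg k H)) (v : L) chi :
  affords v chi ->
  exists eta q, induced_data (Z := induced G (rep_tensor L XH)) chi eta q.
Proof.
move=> vP; pose N : lmodType (skew_alg act H) := rep_tensor L XH.
have [ka' kaK ka'K] := bijective_inverse (rtens_bij vP XH).
pose ka : restrict XH -> restrict N := rtens v.
have kaS : SL 1 ka := rtens_semilinear v XH.
have ka'S : SL 1 (ka' : restrict N -> restrict XH).
  by rewrite -[1%g]invg1; apply: semilinear_inv kaS kaK ka'K.
have ka_gmul h x : h \in H -> gmul h (ka x : N) = (scal (chi h) : A) *: ka (gmul h (x : XH)).
  exact: (gmul_rtens vP (x : XH)).
pose eta : X -> restrict (induced G N) := @ind_in _ _ _ act G H N \o (ka \o phi').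
pose q : restrict (induced G N) -> X :=
  phi \o ((ka' : restrict N -> restrict XH) \o (@ind_out _ _ _ act G H N)).
have inS := ind_in_semilinear G N; have outS := ind_out_semilinear sHG N.
have in_lin := semilinear_klin inS; have ka'_lin := semilinear_klin ka'S.
have etaS : SL 1 eta := semilinear1_comp inS (semilinear1_comp kaS phi'S).
have qS : SL 1 q := semilinear1_comp phiS (semilinear1_comp ka'S outS).
exists eta, q; apply: (InducedData etaS qS).
- move=> h hH x; rewrite /eta /= -ind_in_gmul // ka_gmul //.
  by rewrite (klinZ in_lin) /hact phiK.
- move=> h hH z; rewrite /q /= ind_out_gmul //.
  rewrite -{1}[ind_out z]ka'K -[rtens v _]/(ka _) ka_gmul // (klinZ ka'_lin) kaK.
  by rewrite (klinZ (semilinear_klin phiS)) /hact phiK.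
- move=> x; rewrite /q /eta /=.
  have := ind_out_gmul_in sHG (ka (phi' x) : N) (group1 G).
  by rewrite gmul1 group1 gmul1 => ->; rewrite kaK phi'K.
- move=> z; rewrite [LHS](ind_decomp sHG T_trans z); apply: eq_bigr => i _.
  by rewrite /eta /q /= phiK [ka _]ka'K.
- move=> Y j jS jH; pose j' : restrict N -> restrict Y := j \o (phi \o ka').
  have j'S : SL 1 j' := semilinear1_comp jS (semilinear1_comp phiS ka'S).
  have [|J JE] := @ind_universal _ _ _ act G H N Y j' j'S.
    move=> h hH n; rewrite /j' /=.
    rewrite -{1}[n]ka'K -[rtens v _]/(ka _) ka_gmul // (klinZ ka'_lin) kaK.
    rewrite (klinZ (semilinear_klin phiS)) (klinZ (semilinear_klin jS)).
    by rewrite jH // /hact phiK.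
  by exists J => x; rewrite /eta /= JE /j' /= kaK phi'K.
apply: (restrict_induced sHG T_trans).
apply: (@iso_by _ _ _ (phi \o (ka' : restrict N -> restrict XH))).
  exact: (semilinear_linear (semilinear1_comp phiS ka'S)).
by apply: bij_comp; [exists phi' | exists ka].
Qed.

Lemma residue_hact h u c : h \in H -> SL 1 u -> residue u c ->
  residue (hact h \o u \o hact h^-1) c.
Proof.
move=> hH uS; apply: residue_conj (hact_semilinear hH) (hactK hH) (hactVK hH).
Qed.

Lemma hact_conj_semilinear h u : h \in H -> SL 1 u -> SL 1 (hact h \o u \o hact h^-1).
Proof.
move=> hH uS; have hS := hact_semilinear hH.
have hVS := hact_semilinear (groupVr hH).
by have := semilinear_comp (semilinear_comp hS uS) hVS; rewrite mulg1 mulgV.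
Qed.

(** Equivariance of [F] gives $\chi_1(h) m = \chi_2(h) h m h^{-1}$ for the component [m] on [X].
    Conjugation preserves the residue of [m], which is nonzero once [m] is known to be
    invertible. *)
Lemma induced_data_character (Z1 Z2 : lmodType (skew_alg act G)) chi1 chi2 eta1 eta2 q1 q2 :
  @induced_data Z1 chi1 eta1 q1 -> @induced_data Z2 chi2 eta2 q2 ->
  iso Z1 Z2 -> {in H, chi1 =1 chi2}.
Proof.
move=> D1 D2 [F /bijective_inverse[F' FK F'K]] h hH.
have F'_lin : linear F' by move=> a x y; apply: (can_inj FK); rewrite linearP !F'K.
have [E EF'] := linear_bundle F'_lin.
have FS : SL 1 (F : restrict Z1 -> restrict Z2) := linear_restrict F.
have ES : SL 1 (E : restrict Z2 -> restrict Z1) := linear_restrict E.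
have [e1S e2S] := (eta_semilinear D1, eta_semilinear D2).
have [q1S q2S] := (q_semilinear D1, q_semilinear D2).
pose m : X -> X := q2 \o (F \o eta1).
have FeS := semilinear1_comp FS e1S; have q1ES := semilinear1_comp q1S ES.
have mS : SL 1 m := semilinear1_comp q2S FeS.
pose a (i : I) : X -> X :=
  (q1 \o E) \o ((@gmul _ _ _ act G Z2 (val i) : restrict Z2 -> restrict Z2) \o eta2).
pose b (i : I) : X -> X :=
  q2 \o ((@gmul _ _ _ act G Z2 (val i)^-1 : restrict Z2 -> restrict Z2) \o (F \o eta1)).
have aS i : SL (val i) (a i).
  have := semilinear_comp q1ES (semilinear_comp (gmul_semilinear Z2 (sTG i)) e2S).
  by rewrite mul1g mulg1.
have bS i : SL (val i)^-1 (b i).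
  have := semilinear_comp q2S (semilinear_comp (gmul_semilinear Z2 (groupVr (sTG i))) FeS).
  by rewrite mul1g mulg1.
have abS i : SL 1 (a i \o b i) by rewrite -(mulgV (val i)); apply: semilinear_comp.
(* The coset decomposition of [Z2] is inserted into $q_1 F^{-1} F \eta_1 = 1$. *)
have ab1 x : \sum_i (a i \o b i) x = x.
  rewrite -[RHS](q_eta D1) -[eta1 x in RHS]FK -EF'.
  rewrite [F (eta1 x) in RHS](data_decomp D2).
  by rewrite -[RHS]/((q1 \o E) _) (klin_sum (semilinear_klin q1ES)).
(* Some [b i] is invertible, so the inverse of [val i] lies in [H]; then [b i] is [m] followed by an
   invertible action of [H]. *)
have m_bij : bijective m.
  have [|i _] := bij_sum X_fin X_indec (r := index_enum I) (P := xpredT)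
    (fun i _ => abS i).
    by apply: (@eq_bij _ _ id) => //; exists id.
  case/(bij_compE X_fin (aS i) (bS i)) => _ b_bij.
  have iVH := bij_inertia (groupVr (sTG i)) (bS i) b_bij.
  pose c x := (scal (chi2 (val i)^-1%g) : A) *: hact (val i)^-1 x.
  have cS : SL (val i)^-1 c := semilinearZ _ (hact_semilinear iVH).
  have cm : bijective (c \o m).
    by apply: (eq_bij b_bij) => x; rewrite /b /= (q_gmul D2 iVH).
  by case: (bij_compE X_fin cS mS cm).
have [c mc] := residue_exists X_fin X_indec mS.
have c0 := (residue_bij X_fin X_indec mS mc).1 m_bij.
have mh : residue (fun x => (scal (chi1 h) : A) *: m x) (chi2 h * c).
  have := residueZ X_fin X_indec (d := chi2 h) (hact_conj_semilinear hH mS)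
    (residue_hact hH mS mc).
  apply: eq_residue => x /=; rewrite -(q_gmul D2 hH) -linear_gmul (eta_gmul D1 hH).
  by rewrite hactVK // (klinZ (semilinear_klin FS)) (klinZ (semilinear_klin q2S)).
have mh' := residueZ X_fin X_indec (d := chi1 h) mS mc.
have /eqP := residue_unique X_fin X_indec (semilinearZ _ mS) mh' mh.
by rewrite -subr_eq0 -mulrBl mulf_eq0 (negPf (introN eqP c0)) orbF subr_eq0 => /eqP.
Qed.

(** * The residue character of a module above the orbit sum *)

Section OrbitDecomposition.
Variables (Y : lmodType (skew_alg act G)).
Variables (inY : I -> X -> restrict Y) (outY : I -> restrict Y -> X).
Hypotheses (inYS : forall i, SL (val i) (inY i)).
Hypotheses (outYS : forall i, SL (val i)^-1 (outY i)).
Hypotheses (outY_in : forall i, cancel (inY i) (outY i)).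
Hypotheses (sumY : forall y : restrict Y, y = \sum_i inY i (outY i y)).
Variable i0 : I.
Hypothesis i0H : val i0 \in H.

Let gm (g : gT) : restrict Y -> restrict Y := @gmul _ _ _ act G Y g.
Let gmS g : g \in G -> SL g (gm g) := @gmul_semilinear _ _ _ act G Y g.
(** The representative [i0] of the trivial coset may differ from 1; the action of [val i0] on [X]
    corrects the degree, so that [iota] and [pi] are linear. *)
Let iota : X -> restrict Y := inY i0 \o hact (val i0)^-1.
Let pi : restrict Y -> X := hact (val i0) \o outY i0.
Let iotaS : SL 1 iota.
Proof.
rewrite -(mulgV (val i0)); apply: semilinear_comp (inYS i0) _.
exact: hact_semilinear (groupVr i0H).
Qed.
Let piS : SL 1 pi.
Proof.
rewrite -(mulgV (val i0)); apply: semilinear_comp _ (outYS i0).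
exact: hact_semilinear.
Qed.
Let pi_iota x : pi (iota x) = x.
Proof. by rewrite /pi /iota /= outY_in hactVK. Qed.
Let sum_iota_pi y : y = iota (pi y) + \sum_(i | i != i0) inY i (outY i y).
Proof. by rewrite {1}[y]sumY (bigD1 i0) //= /iota /pi /= hactK. Qed.

Let offH i : i != i0 -> val i \notin H.
Proof.
move=> neq; apply: contra (T_off neq) => iH.
by rewrite groupM ?groupV.
Qed.

(** Compares the action of [h] on [Y] with the one on [X]; its residue is the value of the character
    at [h]. *)
Let u (h : gT) : X -> X := pi \o (gm h \o (iota \o hact h^-1)).
Let uS h : h \in H -> SL 1 (u h).
Proof.
move=> hH; have hG := subsetP sHG h hH.
have := semilinear_comp (gmS hG) (semilinear_comp iotaS (hact_semilinear (groupVr hH))).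
by move/(semilinear_comp piS); rewrite !mul1g mulgV.
Qed.

(* The failure of u to be a cocycle factors through the summands not isomorphic
   to X, so it is not invertible. *)
Lemma residue_multiplicative g h c d : g \in H -> h \in H ->
  residue (u g) c -> residue (u h) d -> residue (u (g * h)%g) (c * d).
Proof.
move=> gH hH uc ud.
have [gG hG] := (subsetP sHG g gH, subsetP sHG h hH).
have S1 := hact_conj_semilinear gH (uS hH).
have R1 := residue_comp X_fin X_indec (uS gH) S1 uc (residue_hact gH (uS hH) ud).
(* Inserting the decomposition of [Y] between [g] and [h] gives $u_{gh} = u_g (g u_h g^{-1}) +
   \sum_{i \neq i_0} e_i e'_i$. *)
pose e i : X -> X := pi \o (gm g \o inY i).
pose e' i : X -> X := outY i \o (gm h \o (iota \o hact (g * h)^-1)).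
have eS i : SL (g * val i) (e i).
  by have := semilinear_comp piS (semilinear_comp (gmS gG) (inYS i)); rewrite mul1g.
have e'S i : SL (g * val i)^-1 (e' i).
  have ghH : (g * h)%g \in H by rewrite groupM.
  have := semilinear_comp iotaS (hact_semilinear (groupVr ghH)).
  move/(semilinear_comp (gmS hG))/(semilinear_comp (outYS i)).
  have -> : ((val i)^-1 * (h * (1 * (g * h)^-1)) = (g * val i)^-1)%g => //.
  by rewrite mul1g !invMg mulKVg.
have eeS i : SL 1 (e i \o e' i).
  by rewrite -(mulgV (g * val i)%g); apply: semilinear_comp.
have eeN i : i != i0 -> residue (e i \o e' i) 0.
  move=> neq; apply/residue0 => /(bij_compE X_fin (eS i) (e'S i))[e_bij _].
  have giG : (g * val i)%g \in G by rewrite groupM // sTG.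
  by have := bij_inertia giG (eS i) e_bij; rewrite groupMl // (negPf (offH neq)).
have R2 := residue_sum X_fin X_indec (r := index_enum I) (fun i (_ : i != i0) => eeS i) eeN.
have S2 : SL 1 (fun x => \sum_(i | i != i0) (e i \o e' i) x).
  by apply: semilinear_sum => i _.
have := residueD X_fin X_indec (semilinear1_comp (uS gH) S1) S2 R1 R2.
rewrite big1 ?addr0 //; apply: eq_residue => x.
have piD := klinD (semilinear_klin piS).
have gD := klinD (semilinear_klin (gmS gG)).
have pi_lin := semilinear_klin piS.
have g_lin := semilinear_klin (gmS gG).
have ghE y : gm (g * h)%g y = gm g (gm h y) by apply: gmulM.
transitivity (pi (gm g (gm h (iota (hact (g * h)^-1 x))))); last by rewrite -ghE.
rewrite [gm h _ in RHS]sum_iota_pi gD piD (klin_sum g_lin) (klin_sum pi_lin).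
congr (_ + _); rewrite /u /= hactK // invMg.
by rewrite hactM ?groupV.
Qed.

(** The embedding [j] is a twisted average over [H], and the retraction is [pi] followed by the
    inverse of [pi \o j]. The retraction is only claimed to be linear over [A]. *)
Lemma equivariant_summand : #|H|%:R != 0 :> k ->
  exists chi (j : X -> restrict Y) (q : restrict Y -> X),
  [/\ chi 1%g = 1, {in H &, {morph chi : g h / (g * h)%g >-> g * h}}, SL 1 j,
      {in H, forall h x, gmul h (j x : Y) = (scal (chi h) : A) *: j (hact h x)}
    & SL 1 q /\ cancel j q].
Proof.
move=> H0.
have /choice[chi chiP] : forall h, exists c, h \in H -> residue (u h) c.
  move=> h; have [hH|] := boolP (h \in H); last by exists 0.
  by have [c cP] := residue_exists X_fin X_indec (uS hH); exists c.
have chiM : {in H &, {morph chi : g h / (g * h)%g >-> g * h}}.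
  move=> g h gH hH; have ghH : (g * h)%g \in H by rewrite groupM.
  have R := residue_multiplicative gH hH (chiP g gH) (chiP h hH).
  exact: (residue_unique X_fin X_indec (uS ghH) (chiP _ ghH) R).
have chi1 : chi 1%g = 1.
  apply: (residue_unique X_fin X_indec (uS (group1 H)) (chiP _ (group1 H))).
  apply: eq_residue (residue_id X_indec) => x.
  by rewrite /u /= invg1 hact1 /gm gmul1 pi_iota.
have chi0 h : h \in H -> chi h != 0.
  move=> hH; apply/eqP => h0; have /eqP := chiM h h^-1%g hH (groupVr hH).
  by rewrite mulgV chi1 h0 mul0r oner_eq0.
pose jh h : X -> restrict Y := gm h \o (iota \o hact h^-1).
have jhS h : h \in H -> SL 1 (jh h).
  move=> hH; have hG := subsetP sHG h hH.
  have := semilinear_comp iotaS (hact_semilinear (groupVr hH)).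
  by move/(semilinear_comp (gmS hG)); rewrite mul1g mulgV.
pose j x := (scal (#|H|%:R^-1) : A) *: \sum_(h in H) (scal (chi h)^-1 : A) *: jh h x.
have jS : SL 1 j.
  apply: semilinearZ; apply: semilinear_sum => h hH.
  by apply: semilinearZ; apply: jhS.
have jE g x : g \in H -> gmul g (j x : Y) = (scal (chi g) : A) *: j (hact g x).
  move=> gH; have gG := subsetP sHG g gH.
  rewrite -[LHS]/(gm g (j x)).
  have g_lin := semilinear_klin (gmS gG).
  rewrite (klinZ g_lin) (klin_sum g_lin) !scalerA scalC -scalerA; congr (_ *: _).
  (* After replacing [h] by $gh$, the weight $\chi(gh)^{-1}$ absorbs the factor $\chi(g)$. *)
  rewrite [RHS]scaler_sumr [RHS](reindex_inj (mulgI g)) /=.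
  apply: eq_big => [h|h hH]; first by rewrite groupMl.
  rewrite (klinZ g_lin) [RHS]scalerA -rmorphM chiM // invfM mulrA mulfV ?chi0 //.
  rewrite mul1r; congr (_ *: _); rewrite /jh /= invMg hactM ?groupV // hactK //.
  by apply/esym; apply: gmulM; rewrite // (subsetP sHG).
pose t := pi \o j.
have tS : SL 1 t := semilinear1_comp piS jS.
(* Each term $\chi(h)^{-1} u_h$ has residue 1, hence so has their average. *)
have t1 : residue t 1.
  have cS h : h \in H -> SL 1 (fun x => (scal (chi h)^-1 : A) *: u h x).
    by move=> hH; apply: semilinearZ; apply: uS.
  have c1 h : h \in H -> residue (fun x => (scal (chi h)^-1 : A) *: u h x) 1.
    move=> hH; rewrite -(mulVf (chi0 h hH)).
    exact: (residueZ X_fin X_indec (uS hH) (chiP h hH)).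
  have := residue_sum X_fin X_indec (r := index_enum gT) cS c1.
  move/(residueZ X_fin X_indec (d := #|H|%:R^-1) (semilinear_sum _ cS)).
  rewrite sumr_const mulVf //; apply: eq_residue => x.
  have pi_lin := semilinear_klin piS.
  rewrite /t /j /= (klinZ pi_lin) (klin_sum pi_lin); congr (_ *: _).
  by apply: eq_bigr => h hH; rewrite (klinZ pi_lin).
have [|t' tK t'K] := @bijective_inverse _ _ t.
  by apply/(residue_bij X_fin X_indec tS t1)/eqP/oner_neq0.
have t'S : SL 1 t' by rewrite -[1%g]invg1; apply: semilinear_inv tS tK t'K.
exists chi, j, (t' \o pi); split=> //; first by move=> h hH x; apply: jE.
by split; [exact: semilinear1_comp t'S piS | exact: tK].
Qed.

End OrbitDecomposition.

(** The map [J] from [Z] extends [j]. If it kills [z], then [orbit_sum_inj], with the translates of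
    [j] and of its retraction, shows that all coset components of [z] vanish; equality of dimensions
    does the rest. *)
Lemma induced_of_restrict (Y : lmodType (skew_alg act G)) : #|H|%:R != 0 :> k ->
  iso (restrict Y) (twist_sum act T X) ->
  exists chi, [/\ chi 1%g = 1, {in H &, {morph chi : g h / (g * h)%g >-> g * h}}
    & forall Z chi' eta q, @induced_data Z chi' eta q -> {in H, chi' =1 chi} -> iso Y Z].
Proof.
move=> H0 YM; have [f /bijective_inverse[f' fK f'K]] := YM.
have fS := linear_semilinear act f.
have f'S : SL 1 f' by rewrite -[1%g]invg1; apply: semilinear_inv fS fK f'K.
have [i0 [i0H _]] := (left_transversalP T_trans).2 _ (group1 G).
have {}i0H : val i0 \in H by rewrite -groupV -[(_^-1)%g]mulg1.
pose inY (i : I) : X -> restrict Y := f' \o ts_in act i.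
pose outY (i : I) : restrict Y -> X := ts_out i \o f.
have inYS i : SL (val i) (inY i).
  by have := semilinear_comp f'S (ts_in_semilinear act X i); rewrite mul1g.
have outYS i : SL (val i)^-1 (outY i).
  by have := semilinear_comp (ts_out_semilinear act X i) fS; rewrite mulg1.
have outY_in i : cancel (inY i) (outY i).
  by move=> x; rewrite /outY /inY /= f'K ts_out_in.
have sumY y : y = \sum_i inY i (outY i y).
  rewrite -(klin_sum (semilinear_klin f'S)) -[LHS]fK; congr f'.
  exact: ts_in_out.
have [chi [j [q [chi1 chiM jS jH [qS jK]]]]] :=
  equivariant_summand inYS outYS outY_in sumY i0H H0.
exists chi; split=> // Z chi' eta q' D chi_eq.
have [|J Jeta] := data_universal D jS.
  by move=> h hH x; rewrite jH // chi_eq.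
apply: iso_sym; exists J.
have JS : SL 1 (J : restrict Z -> restrict Y) := linear_restrict J.
apply: (inj_iso_bij (twist_sum_fin_dim act T X_fin) (data_restrict D) YM
  (semilinear_klin JS)).
apply: (klin_inj (semilinear_klin JS)) => z Jz.
have gmS (i : I) := gmul_semilinear Y (sTG i).
have gmVS (i : I) := gmul_semilinear Y (groupVr (sTG i)).
pose a (i : I) : X -> restrict Y := (@gmul _ _ _ act G Y (val i) : restrict Y -> _) \o j.
pose b (i : I) : restrict Y -> X := q \o (@gmul _ _ _ act G Y (val i)^-1 : restrict Y -> _).
have aS i : SL (val i) (a i) by have := semilinear_comp (gmS i) jS; rewrite mulg1.
have bS i : SL (val i)^-1 (b i) by have := semilinear_comp qS (gmVS i); rewrite mul1g.
have ba i : bijective (b i \o a i).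
  by apply: (@eq_bij _ _ id) => [|x]; [exists id | rewrite /b /a /= gmulK ?sTG ?jK].
have x0 := @orbit_sum_inj _ a b (fun i => q' (gmul (val i)^-1 (z : Z))) aS bS ba.
rewrite (data_decomp D z) big1 // => i _; rewrite x0.
  by rewrite (klin0 (semilinear_klin (eta_semilinear D))) /gmul scaler0.
rewrite -[RHS]Jz [in RHS](data_decomp D z) (klin_sum (semilinear_klin JS)).
by apply: eq_bigr => i' _; rewrite /a /= -Jeta -linear_gmul.
Qed.

End Clifford.

(** * Classification of the module structures above the orbit sum *)

Lemma g_invariant_iso (k : pzRingType) (A : kalgType k) (gT : finGroupType)
    (act : alg_action A gT) (G : {group gT}) (M N : lmodType A) :
  iso M N -> g_invariant act G M -> g_invariant act G N.
Proof.
move=> MN M_inv g gG; apply: iso_trans (iso_trans (M_inv g gG) MN).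
have [f fb] := iso_sym MN.
apply: (@iso_by _ (twist act g N) (twist act g M) f) => // a x y.
exact: (linearP f (act g^-1%g a) (x : N) (y : N)).
Qed.

Lemma card_subgroup_natf_neq0 (k : fieldType) (gT : finGroupType) (G H : {group gT}) :
  H \subset G -> (forall p, p \in [pchar k] -> ~~ (p %| #|G|)%N) ->
  #|H|%:R != 0 :> k.
Proof.
move=> sHG pG; apply/negP => H0.
have [p p_char] := natf0_pchar (cardG_gt0 H) H0.
have /negP[] := pG p p_char; apply: dvdn_trans (cardSg sHG).
by rewrite (dvdn_pcharf p_char).
Qed.

(** The residue character of [Y] occurs among the [rho i], which gives existence; uniqueness holds
    because isomorphic induced modules have equal characters and these determine the index. *)
Theorem equivariant_structures (k : closedFieldType) (A : kalgType k)
    (gT : finGroupType) (act : alg_action A gT) (G : {group gT}) (X : lmodType A)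
    (T : {set gT}) (I : finType)
    (rho : I -> lmodType (group_alg k (inertia act G X)))
    (XH : lmodType (skew_alg act (inertia act G X))) :
  (forall p, p \in [pchar k] -> ~~ (p %| #|G|)%N) ->
  fin_dim X ->
  indecomposable X ->
  abelian (inertia act G X) ->
  is_transversal T (lcosets (inertia act G X) G) G ->
  (forall i, irreducible (rho i)) ->
  iso ((group_alg k (inertia act G X))^o : lmodType (group_alg k (inertia act G X)))
    (dsum rho) ->
  iso (restrict XH) X ->
  [/\ forall Y : lmodType (skew_alg act G),
        iso (restrict Y) (twist_sum act T X) ->
        exists! i, iso Y (induced G (rep_tensor (rho i) XH)),
      indecomposable_g_invariant act G (twist_sum act T X)
    & exists Z : I -> lmodType (skew_alg act G),
      [/\ forall i, iso (restrict (Z i)) (twist_sum act T X),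
          forall i j, iso (Z i) (Z j) -> i = j
        & forall Y : lmodType (skew_alg act G),
            iso (restrict Y) (twist_sum act T X) -> exists i, iso Y (Z i)]].
Proof.
set H := inertia act G X.
move=> pG X_fin X_indec abH T_trans rho_irr rho_reg [phi phi_bij].
have [phi' phiK phi'K] := bijective_inverse phi_bij.
have sHG : H \subset G by apply/subsetP=> g; rewrite inE => /andP[].
have H0 := card_subgroup_natf_neq0 sHG pG.
have aff i := irreducible_affords abH (rho_irr i).
pose v i : rho i := projT1 (cid (aff i)).
pose chi i : gT -> k := projT1 (cid (projT2 (cid (aff i)))).
have vP i : affords (v i) (chi i) := projT2 (cid (projT2 (cid (aff i)))).
pose Z i : lmodType (skew_alg act G) := induced G (rep_tensor (rho i) XH).
have D i := induced_rep_tensor_data T_trans phiK phi'K (vP i).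
have Z_restrict i : iso (restrict (Z i)) (twist_sum act T X).
  by have [eta [q Di]] := D i; apply: data_restrict Di.
have Z_inj i j : iso (Z i) (Z j) -> i = j.
  have [eta [q Di]] := D i; have [eta' [q' Dj]] := D j => Zij.
  apply: (characters_distinct vP rho_reg).
  exact: (induced_data_character X_fin X_indec T_trans phiK phi'K Di Dj Zij).
have Z_all (Y : lmodType (skew_alg act G)) :
    iso (restrict Y) (twist_sum act T X) -> exists i, iso Y (Z i).
  move=> YM.
  have [psi [psi1 psiM psiZ]] := induced_of_restrict X_fin X_indec T_trans phiK phi'K H0 YM.
  have [i chi_i] := character_occurs vP rho_reg psi1 psiM.
  have [eta [q Di]] := D i.
  by exists i; apply: psiZ Di chi_i.
(* The trivial character supplies an index, so that the orbit sum is the restriction of some [Z i0]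
   and therefore [G]-invariant. *)
have [i0 _] : exists i, {in H, chi i =1 fun=> 1}.
  by apply: (character_occurs vP rho_reg) => // g h _ _; rewrite mulr1.
split; last by exists Z.
- move=> Y YM; have [i Yi] := Z_all Y YM; exists i; split=> // j Yj.
  exact: Z_inj (iso_trans (iso_sym Yi) Yj).
apply: (twist_sum_indecomposable X_fin X_indec T_trans).
exact: g_invariant_iso (Z_restrict i0) (restrict_g_invariant _).
Qed.

Theorem theorem1p1 (k : closedFieldType) (Q : quiver)
  (I : ideal (path_alg k Q))
  (Lambda := bound_alg I)
  (G : {group subg_of (autQI I)})
  (act := autQI_action I)
  (X : lmodType Lambda)
  (HX := inertia act G X)
  (r := #|HX|)
  (GX : {set subg_of (autQI I)})
  (rho : 'I_r -> lmodType (group_alg k HX))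
  (XH : lmodType (skew_alg act HX)) :
  (forall p, p \in [pchar k] -> ~~ (p %| #|G|)%N) ->
  fin_dim X ->
  indecomposable X ->
  abelian HX ->
  is_transversal GX (lcosets HX G) G ->
  (forall i, irreducible (rho i)) ->
  iso ((group_alg k HX)^o : lmodType (group_alg k HX)) (dsum rho) ->
  iso (restrict XH) X ->
  [/\ forall Y : lmodType (skew_alg act G),
        iso (restrict Y) (twist_sum act GX X) ->
        exists! i : 'I_r, iso Y (induced G (rep_tensor (rho i) XH)),
      indecomposable_g_invariant act G (twist_sum act GX X)
    & exists Z : 'I_r -> lmodType (skew_alg act G),
      [/\ forall i, iso (restrict (Z i)) (twist_sum act GX X),
          forall i j, iso (Z i) (Z j) -> i = j
        & forall Y : lmodType (skew_alg act G),
            iso (restrict Y) (twist_sum act GX X) -> exists i, iso Y (Z i)]].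
Proof.
(* The general statement for the action of [G] on the bound quiver algebra, with summands indexed by
   ['I_r]. *)
exact: equivariant_structures.
Qed.
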